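(* The family of right $A$-modules $W(K)$, where $K$ ranges over all infinite $\mu$-sets, is a family of irreducible infinite-dimensional right modules which separates the points of $A$: for every non-zero $a\in A$ there are an infinite $\mu$-set $K$ and $f\in W(K)$ with $f\,a\ne0$. Likewise the family of right $B$-modules $C(K)$, where $K$ ranges over all infinite $\mu$-sets, is a family of irreducible infinite-dimensional right modules which separates the points of $B$.
   Context: $\mathbb{T}$ is the unit circle. $W$ denotes the Wiener algebra of continuous complex functions on $\mathbb{T}$ with absolutely convergent Fourier series; for $\phi\in W$, $\|\phi\|_1$ is the sum of the absolute values of its Fourier coefficients. $A$ is the Banach algebra of formal series $a=\sum_{m=0}^\infty x^m\phi_m$ (also written $\sum x^m\phi_m(y)$) with $\phi_m\in W$ and $\|a\|=\sum_m\|\phi_m\|_1<\infty$. $B$ is the Banach algebra of formal series $b=\sum_{m=0}^\infty x^m\phi_m$ with $\phi_m\in C(\mathbb{T})$ and $\|b\|=\sum_m\|\phi_m\|_\infty<\infty$. Here $y$ is identified with the function $\zeta\mapsto\zeta$, and in both algebras the product is determined by $(x^m\phi)(x^n\psi)=x^{m+n}\,\phi(\zeta^{2^n})\psi(\zeta)$; in particular $yx=xy^2$ and $y$ is invertible. A subset $K\subseteq\mathbb{T}$ is square-closed if $\zeta^2\in K$ whenever $\zeta\in K$. A $\mu$-set is a non-empty compact square-closed subset of $\mathbb{T}$ which is minimal, with respect to set inclusion, amongst all non-empty compact square-closed subsets of $\mathbb{T}$. For a compact square-closed set $K$, $W(K)$ is the quotient $W/N$, $N=\{f\in W: f(K)=(0)\}$,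 identified with the space of restrictions to $K$ of the functions in $W$. The right actions of $A$ on $W(K)$ and of $B$ on $C(K)$ are given by $(f\,x)(\zeta)=f(\zeta^2)$, $(f\,y)(\zeta)=\zeta f(\zeta)$ for $\zeta\in K$; thus $\left(f\sum_m x^m\phi_m\right)(\zeta)=\sum_m f(\zeta^{2^m})\phi_m(\zeta)$. A right module is irreducible if the action is non-zero and it has no submodules other than $(0)$ and itself (in the purely algebraic sense). *)

(* Defs.v *)
From HB Require Import structures.
From mathcomp Require Import all_boot all_order all_algebra.
From mathcomp Require Import complex.
From mathcomp Require Import all_classical all_reals all_analysis.

Set Implicit Arguments.
Unset Strict Implicit.
Unset Printing Implicit Defensive.

Import Order.TTheory GRing.Theory Num.Theory.
Import numFieldNormedType.Exports.

Local Open Scope classical_set_scope.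
Local Open Scope ring_scope.

Section modules.
Context (F : pzRingType) (E V : lmodType F).
Variables (A : set E) (mul : E -> E -> E) (one : E).
Variables (act : V -> E -> V) (M : set V).

Record right_module : Prop := {
  rmod_zero : M 0;
  rmod_add : forall u v, M u -> M v -> M (u + v);
  rmod_scale : forall (k : F) u, M u -> M (k *: u);
  rmod_act : forall u a, M u -> A a -> M (act u a);
  rmod_linl : forall (k : F) u v a, M u -> M v -> A a ->
    act (k *: u + v) a = k *: act u a + act v a;
  rmod_linr : forall (k : F) u a b, M u -> A a -> A b ->
    act u (k *: a + b) = k *: act u a + act u b;
  rmod_mul : forall u a b, M u -> A a -> A b ->
    act (act u a) b = act u (mul a b);
  rmod_one : forall u, M u -> act u one = u }.

(* Only an additive subgroup is required: when A is unital, stability under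
   scalars follows from stability under the action. *)
Record submodule (S : set V) : Prop := {
  submod_sub : S `<=` M;
  submod_zero : S 0;
  submod_diff : forall u v, S u -> S v -> S (u - v);
  submod_act : forall u a, S u -> A a -> S (act u a) }.

Definition irreducible_module : Prop :=
  (exists u a, [/\ M u, A a & act u a <> 0]) /\
  (forall S : set V, submodule S -> S = [set 0] \/ S = M).

Definition infinite_dimensional : Prop :=
  ~ exists (n : nat) (e : 'I_n -> V),
      (forall i, M (e i)) /\
      (forall u, M u -> exists c : 'I_n -> F, u = \sum_(i < n) c i *: e i).

End modules.

(* The type of complex numbers is taken as [R[i]^o] so that it carries its
   topology and its structure of vector space over [R[i]]. *)
Definition unit_circle (R : realType) : set R[i]^o := [set z | `|z| = 1].

(* [set_type] carries the topology induced by the inclusion; the same holds for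
   a subset [K] of the circle used as a type. *)
Notation circle R := (set_type (@unit_circle R)).

Section circle.
Context (R : realType).
Implicit Types (z : circle R) (t : R).

Lemma circle_pow_subproof z n : (set_val z ^+ n) \in @unit_circle R.
Proof.
by apply/mem_set; rewrite /unit_circle /= normrX (set_valP z) expr1n.
Qed.

Definition circle_pow z n : circle R := SigSub (circle_pow_subproof z n).

Lemma expi_subproof t : ((cos t +i* sin t)%C : R[i]^o) \in @unit_circle R.
Proof.
by apply/mem_set; rewrite /unit_circle /= normc_def /= cos2Dsin2 sqrtr1.
Qed.

Definition expi t : circle R := SigSub (expi_subproof t).

Definition square_closed (K : set (circle R)) : Prop :=
  forall z, K z -> K (circle_pow z 2).

Record mu_set (K : set (circle R)) : Prop := {
  mu_nonempty : K !=set0;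
  mu_compact : compact K;
  mu_square : square_closed K;
  mu_minimal : forall L : set (circle R),
    L !=set0 -> compact L -> square_closed L -> L `<=` K -> L = K }.

Lemma circle_powM z m n : circle_pow (circle_pow z m) n = circle_pow z (m * n).
Proof. by apply/val_inj; rewrite /= -exprM. Qed.

Lemma square_closed_pow2 (K : set (circle R)) (sqK : square_closed K) n z :
  K z -> K (circle_pow z (2 ^ n)).
Proof.
move=> Kz; elim: n => [|n IHn].
  have -> : circle_pow z (2 ^ 0) = z by apply: val_inj; rewrite /= expr1.
  exact: Kz.
by rewrite expnSr -circle_powM; exact: sqK.
Qed.

Lemma pow2_subproof (K : set (circle R)) (sqK : square_closed K) n (z : K) :
  circle_pow (set_val z) (2 ^ n) \in K.
Proof. by apply/mem_set; apply: square_closed_pow2 => //; exact: set_valP. Qed.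

(* The map z |-> z^(2^n) from K to itself. *)
Definition pow2 (K : set (circle R)) (sqK : square_closed K) n (z : K) :
    set_type K :=
  SigSub (pow2_subproof sqK n z).

End circle.

Section function_spaces.
Context (R : realType).
Implicit Types phi : circle R -> R[i]^o.

(* (2 pi)^-1 * \int_0^(2 pi) phi(e^(it)) e^(-ikt) dt, split into real and
   imaginary parts since the library integrates real functions only *)
Definition fourier phi (k : int) : R[i]^o :=
  let g t : R[i] := phi (expi t) * set_val (expi t) ^ (- k) in
  let I := `[0, pi *+ 2]%classic : set R in
  ((pi *+ 2)^-1 * (\int[lebesgue_measure]_(t in I) complex.Re (g t))
   +i* ((pi *+ 2)^-1 * (\int[lebesgue_measure]_(t in I) complex.Im (g t))))%C.

Definition norm1 phi : \bar R :=
  (\esum_(k in [set: int]) (Normc.normc (fourier phi k))%:E)%E.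

Definition norm_sup phi : \bar R :=
  ereal_sup [set (Normc.normc (phi z))%:E | z in [set: circle R]].

Definition wiener phi : Prop := continuous phi /\ (norm1 phi < +oo)%E.

End function_spaces.

(* The sequence [a] stands for the formal series \sum_m x^m a_m. *)
Notation fseries R := (nat -> circle R -> R[i]^o).

Section algebras.
Context (R : realType).
Implicit Types (a b : fseries R) (K : set (circle R)).

Definition algA : set (fseries R) :=
  [set a | (forall m, wiener (a m)) /\ (\sum_(0 <= m <oo) norm1 (a m) < +oo)%E].

Definition algB : set (fseries R) :=
  [set a | (forall m, continuous (a m)) /\
           (\sum_(0 <= m <oo) norm_sup (a m) < +oo)%E].

(* (x^m phi) (x^n psi) = x^(m + n) phi(z^(2^n)) psi(z) *)
Definition fmul a b : fseries R := fun k z =>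
  \sum_(n < k.+1) a (k - n)%N (circle_pow z (2 ^ n)) * b n z.

Definition fone : fseries R := fun m _ => (m == 0%N)%:R.

Definition WK K : set (K -> R[i]^o) :=
  [set f | exists2 g, wiener g & f = g \o set_val].

Definition CK K : set (K -> R[i]^o) := [set f | continuous f].

Definition act K (sqK : square_closed K) (f : K -> R[i]^o) a : K -> R[i]^o :=
  fun z => limn (series (fun m => f (pow2 sqK m z) * a m (set_val z))).

End algebras.

Arguments algA {R}.
Arguments algB {R}.
Arguments fmul {R}.
Arguments fone {R}.
Arguments WK {R} K _.
Arguments CK {R} K _.

(* Main.v *)
Require Import Defs.
From mathcomp Require Import all_boot all_order all_algebra.
From mathcomp Require Import complex.
From mathcomp Require Import all_classical all_reals all_analysis.
From mathcomp Require Import ring lra.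
From mathcomp Require Import zify.
From mathcomp Require cyclic.
Import Order.TTheory GRing.Theory Num.Theory.
Import numFieldNormedType.Exports.
Local Open Scope classical_set_scope.
Local Open Scope ring_scope.

(** The proof has three ingredients.

    _The Wiener algebra._  Everything is expressed through balls: [wball C phi]
    says that [phi] is a uniform limit of trigonometric polynomials whose
    coefficients have absolute sum at most [C].  Such a function is in W with
    norm at most [C] ([wball_wiener]); the converse ([wiener_wball]) is Fourier
    inversion, obtained by convolution with the kernel
    [(1 + u)^(2n) / (C(2n, n) u^n)].  Sums, products, composition with powers
    and completeness of W then follow from finite computations.  The norm of the
    powers [u^n] is controlled by the sup norm of [u] ([wball_powers]), because
    a trigonometric polynomial of degree N bounded by B has at most 2N + 1
    coefficients, each bounded by B.  Hence [1 - u] is invertible when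
    [|u| <= B < 1], and a positive function of W has its inverse in W.  Bump
    functions in W come from [|cos t|], which is one minus a uniform limit of
    polynomials in [sin^2 t] of norm at most 1 in W.  Adding bumps that vanish
    on a compact set [K], one inverts on [K] any non-negative function of W that
    is positive on [K] ([wiener_inv_on]).

    _Irreducibility._  The pairs (W, A) and (C(T), B) share the properties
    gathered in the record [function_algebra], for C(T) by Tietze's theorem.
    Let [f] be a non-zero element of a submodule.  By minimality every orbit of
    [z -> z^2] in [K] is dense in [K], so by compactness finitely many
    [|f (z^(2^n))|^2] have a positive sum on [K].  This sum belongs to the
    submodule and is invertible ([irreducible_restrictions]).

    _Separation._  The orbit closure of a uniformly recurrent point is minimal
    ([recurrent_mu_set]).  A point [zeta] that is recurrent and of infinite
    order is given by the binary digits [n -> v_2 (n + 1) mod 2], [v_2] being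
    the 2-adic valuation.  All powers [zeta^q] with [q > 0] inherit both
    properties, since [z -> z^q] commutes with squaring.  If a series [a] kills
    all the modules, testing against bumps along the orbit of [zeta^q] gives
    [a_m (zeta^q) = 0] ([coefficients_eq0]), and the powers of [zeta] being
    equidistributed, all Fourier coefficients of [a_m] vanish
    ([continuous_eq0_powers]). *)

Set Implicit Arguments.
Unset Strict Implicit.
Unset Printing Implicit Defensive.

(** * The modulus of complex numbers and complex convergence *)

Section complex_modulus.
Context (R : realType).
Implicit Types (x y z : R[i]) (r s : R).
Local Notation nc := (@Normc.normc R).

Lemma cnormE z : `|z| = (nc z)%:C%C.
Proof. by rewrite normc_def; case: z. Qed.

Lemma nc_ge0 z : 0 <= nc z.
Proof. by case: z => a b; exact: sqrtr_ge0. Qed.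

Lemma ncD x y : nc (x + y) <= nc x + nc y.
Proof. exact: le_normcD. Qed.

Lemma ncN x : nc (- x) = nc x.
Proof. exact: normcN. Qed.

Lemma ncB x y : nc (x - y) = nc (y - x).
Proof. by rewrite -ncN opprB. Qed.

Lemma ncM x y : nc (x * y) = nc x * nc y.
Proof. exact: Normc.normcM. Qed.

Lemma nc_real r : nc r%:C%C = `|r|.
Proof. by rewrite /= expr0n /= addr0 sqrtr_sqr. Qed.

Lemma nc0 : nc 0 = 0.
Proof. exact: Normc.normc0. Qed.

Lemma nc1 : nc 1 = 1.
Proof. exact: Normc.normc1. Qed.

Lemma ncX z n : nc (z ^+ n) = nc z ^+ n.
Proof. by elim: n => [|n IH]; rewrite ?expr0 ?nc1 // !exprS ncM IH. Qed.

Lemma ncV z : nc z^-1 = (nc z)^-1.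
Proof. exact: Normc.normcV. Qed.

Lemma ncXz z (k : int) : nc (z ^ k) = nc z ^ k.
Proof. by case: k => n; rewrite ?NegzE ?exprnN -?exprnP ?ncV ncX. Qed.

Lemma nc_conj z : nc (z^*)%C = nc z.
Proof. by case: z => a b /=; rewrite sqrrN. Qed.

Lemma nc_eq0 z : nc z = 0 -> z = 0.
Proof. exact: Normc.eq0_normc. Qed.

Lemma Re_le_nc z : `|complex.Re z| <= nc z.
Proof.
case: z => a b /=; rewrite -sqrtr_sqr ler_wsqrtr // lerDl; exact: sqr_ge0.
Qed.

Lemma Im_le_nc z : `|complex.Im z| <= nc z.
Proof.
case: z => a b /=; rewrite -sqrtr_sqr ler_wsqrtr // lerDr; exact: sqr_ge0.
Qed.

Lemma nc_le_ReIm z : nc z <= `|complex.Re z| + `|complex.Im z|.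
Proof.
case: z => a b /=; rewrite -[leRHS]ger0_norm ?addr_ge0 // -sqrtr_sqr.
rewrite ler_wsqrtr // sqrrD !real_normK ?num_real //.
by rewrite -addrA [X in _ <= _ + X]addrC addrA lerDl mulrn_wge0 // mulr_ge0.
Qed.

Lemma nc_sqr z : ((nc z) ^+ 2)%:C%C = z * (z^*)%C.
Proof.
case: z => a b /=; rewrite sqr_sqrtr ?addr_ge0 ?sqr_ge0 //.
by simpc; rewrite -!expr2; congr (_ +i* _)%C; rewrite mulrC addNr.
Qed.

Lemma nc_sum (I : Type) (s : seq I) (P : pred I) (F : I -> R[i]) :
  nc (\sum_(i <- s | P i) F i) <= \sum_(i <- s | P i) nc (F i).
Proof.
elim/big_ind2: _ => // [|x1 r1 x2 r2 h1 h2]; first by rewrite nc0.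
exact: le_trans (ncD _ _) (lerD h1 h2).
Qed.

Lemma real_complexD r s : ((r + s)%:C)%C = ((r%:C)%C + (s%:C)%C) :> R[i].
Proof. exact: raddfD. Qed.

Lemma real_complexM r s : ((r * s)%:C)%C = ((r%:C)%C * (s%:C)%C) :> R[i].
Proof. exact: rmorphM. Qed.

Lemma cvgCP (T : Type) (F : set_system T) (FF : Filter F) (f : T -> R[i]^o)
    (l : R[i]^o) :
  f @ F --> l <-> forall e : R, 0 < e -> \forall t \near F, nc (f t - l) < e.
Proof.
split=> [/cvgrPdist_lt h e e0|h].
  have /h : 0 < (e%:C)%C :> R[i] by rewrite ltcR.
  by apply: filterS => t; rewrite cnormE ltcR ncB.
apply/cvgrPdist_lt => e; rewrite ltcE /= => /andP[/eqP ie e0].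
have ee : e = ((complex.Re e)%:C)%C by case: e ie e0 => a b /= ->.
have := h _ e0; apply: filterS => t.
by rewrite cnormE ee ltcR ncB.
Qed.

Lemma cvgC_uniq (u : nat -> R[i]^o) (l : R[i]^o) : u @ \oo --> l -> limn u = l.
Proof. by move=> h; apply/cvg_lim => //; exact: norm_hausdorff. Qed.

(** A bound valid along a convergent sequence is inherited by its limit. *)
Lemma nc_limn_le (u : nat -> R[i]^o) (l w : R[i]^o) (r : R) :
  u @ \oo --> l -> (\forall n \near \oo, nc (u n - w) <= r) -> nc (l - w) <= r.
Proof.
move=> /cvgCP h b; apply/ler_addgt0Pr => e e0.
have [N _ hN] := filterI b (h e e0).
have [/= h1 h2] := hN N (leqnn N).
have -> : l - w = (u N - w) - (u N - l) by ring.
rewrite (le_trans (ncD _ _)) // ncN lerD //; exact: ltW.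
Qed.

(** Absolutely convergent complex series converge. *)
Lemma cvgC_series (u : nat -> R[i]^o) (v : nat -> R) :
  (forall n, nc (u n) <= v n) -> cvgn (series v) -> cvgn (series u).
Proof.
move=> uv cv.
have v0 n : 0 <= v n by exact: le_trans (nc_ge0 _) (uv n).
have cRe : cvgn (series (fun n => complex.Re (u n))).
  apply: normed_cvg; apply: (@series_le_cvg _ _ v) => // n; first exact: normr_ge0.
  exact: le_trans (Re_le_nc (u n)) (uv n).
have cIm : cvgn (series (fun n => complex.Im (u n))).
  apply: normed_cvg; apply: (@series_le_cvg _ _ v) => // n; first exact: normr_ge0.
  exact: le_trans (Im_le_nc (u n)) (uv n).
have [a ha] : exists a : R, series (fun n => complex.Re (u n)) @ \oo --> a by eexists; exact: cRe.
have [b hb] : exists b : R, series (fun n => complex.Im (u n)) @ \oo --> b by eexists; exact: cIm.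
suff h : series u @ \oo --> ((a +i* b)%C : R[i]^o) by exact: cvgP h.
apply/cvgCP => e e0.
have e2 : 0 < e / 2 by rewrite divr_gt0.
move/cvgrPdist_lt : ha => /(_ _ e2) ha.
move/cvgrPdist_lt : hb => /(_ _ e2) hb.
apply: (filterS _ (filterI ha hb)) => n [/= ha1 hb1].
rewrite (le_lt_trans (nc_le_ReIm _)) // [ltRHS]splitr.
have E : series u n = ((series (fun n => complex.Re (u n)) n)
                 +i* (series (fun n => complex.Im (u n)) n))%C.
  rewrite /series /=; elim/big_ind3: _ => // [x1 x2 x3 y1 y2 y3 -> ->|i _].
    by simpc.
  by case: (u i).
by rewrite E; simpc; rewrite /= ltrD // distrC.
Qed.

End complex_modulus.

(** * Topology of the circle *)

Section circle_topology.
Context (R : realType).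
Implicit Types (z w : circle R) (K : set (circle R)) (U : set (circle R)).
Local Notation nc := (@Normc.normc R).

(** The complex number underlying a point of the circle. *)
Definition cval z : R[i] := set_val z.

Lemma cval_inj z w : cval z = cval w -> z = w.
Proof. by rewrite /cval !set_valE => /val_inj. Qed.

Lemma nc_cval z : nc (cval z) = 1.
Proof. by have := set_valP z; rewrite /unit_circle /= cnormE => -[]. Qed.

Lemma cval_neq0 z : cval z != 0.
Proof.
apply/eqP => h; have := nc_cval z; rewrite h nc0 => /eqP.
by rewrite eq_sym oner_eq0.
Qed.

Lemma nc_cvalXz z (k : int) : nc (cval z ^ k) = 1.
Proof. by rewrite ncXz nc_cval exp1rz. Qed.

Lemma cval_pow z n : cval (circle_pow z n) = cval z ^+ n.
Proof. by []. Qed.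

Lemma cval_conj z : ((cval z)^*)%C = (cval z)^-1.
Proof.
apply: (mulfI (cval_neq0 z)); rewrite -nc_sqr nc_cval expr1n.
by rewrite divff ?cval_neq0.
Qed.

(** Product and inverse in the group of complex numbers of modulus 1. *)
Lemma circle_mul_subproof z w : (cval z * cval w : R[i]^o) \in @unit_circle R.
Proof.
by apply/mem_set; rewrite /unit_circle /= cnormE ncM !nc_cval mulr1.
Qed.

Definition circle_mul z w : circle R := SigSub (circle_mul_subproof z w).

Lemma cval_mul z w : cval (circle_mul z w) = cval z * cval w.
Proof. by []. Qed.

Lemma circle_inv_subproof z : ((cval z)^-1 : R[i]^o) \in @unit_circle R.
Proof.
by apply/mem_set; rewrite /unit_circle /= cnormE ncV nc_cval invr1.
Qed.

Definition circle_inv z : circle R := SigSub (circle_inv_subproof z).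

Lemma cval_inv z : cval (circle_inv z) = (cval z)^-1.
Proof. by []. Qed.

Lemma nbhs_set_typeP (T : topologicalType) (A : set T) (x : A) (V : set A) :
  nbhs x V <-> exists2 W, nbhs (set_val x) W & set_val @^-1` W `<=` V.
Proof.
split=> [[V1 [[W oW <-] Wx] sV]|[W nW sW]].
  by exists W => //; exact: open_nbhs_nbhs.
apply: (@filterS _ (nbhs x) _ _ _ sW).
exact: (@initial_continuous _ _ (@set_val _ A) x).
Qed.

(** The topology of the circle, and below that of its subsets, is the metric
    topology of the complex plane. *)
Lemma nbhs_circleP z U :
  nbhs z U <-> exists2 e : R, 0 < e &
    forall w, nc (cval w - cval z) < e -> U w.
Proof.
rewrite nbhs_set_typeP; split=> [[W nW sW]|[e e0 h]].
  have [e] := (nbhs_ballP (set_val z : R[i]^o) W).1 nW.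
  rewrite /= ltcE /= => /andP[/eqP ie e0] sb.
  exists (complex.Re e) => // w zw; apply: sW; apply: sb.
  rewrite /ball /=; have -> : e = ((complex.Re e)%:C)%C.
    by case: e ie {e0 zw} => a b /= ->.
  by rewrite cnormE ltcR ncB.
exists [set y | nc (y - set_val z) < e]; last by move=> w /= /h.
have h1 : id @ nbhs (set_val z : R[i]^o) --> (set_val z : R[i]^o) by exact: cvg_id.
exact: ((@cvgCP _ _ _ _ _ _).1 h1 e e0).
Qed.

Lemma nbhs_subcircleP K (z : K) (V : set K) :
  nbhs z V <-> exists2 e : R, 0 < e &
    forall w : K, nc (cval (set_val w) - cval (set_val z)) < e -> V w.
Proof.
rewrite nbhs_set_typeP; split=> [[W /nbhs_circleP[e e0 h] sW]|[e e0 h]].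
  by exists e => // w zw; apply: sW; exact: h.
exists [set w | nc (cval w - cval (set_val z)) < e].
  by apply/nbhs_circleP; exists e.
by move=> w /= /h.
Qed.

Lemma continuous_circleP (phi : circle R -> R[i]^o) :
  continuous phi <-> forall z (e : R), 0 < e -> exists2 d : R, 0 < d &
    forall w, nc (cval w - cval z) < d -> nc (phi w - phi z) < e.
Proof.
split=> [h z e e0|h z].
  exact: (nbhs_circleP _ _).1 ((@cvgCP _ _ _ _ _ _).1 (h z) e e0).
apply: (@cvgCP R _ (nbhs z) _ phi (phi z)).2 => e e0.
exact: (nbhs_circleP _ _).2 (h z e e0).
Qed.

Lemma continuous_subcircleP K (phi : K -> R[i]^o) :
  continuous phi <-> forall (z : K) (e : R), 0 < e -> exists2 d : R, 0 < d &
    forall w : K, nc (cval (set_val w) - cval (set_val z)) < d ->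
      nc (phi w - phi z) < e.
Proof.
split=> [h z e e0|h z].
  exact: (nbhs_subcircleP _ _).1 ((@cvgCP _ _ _ _ _ _).1 (h z) e e0).
apply: (@cvgCP R _ (nbhs z) _ phi (phi z)).2 => e e0.
exact: (nbhs_subcircleP _ _).2 (h z e e0).
Qed.

Lemma circle_hausdorff : hausdorff_space (circle R).
Proof.
move=> z w h; apply: cval_inj; apply/eqP; rewrite -subr_eq0; apply/negPn/negP.
move=> zw; have d0 : 0 < nc (cval z - cval w).
  rewrite lt_neqAle nc_ge0 andbT eq_sym; apply: contra zw => /eqP/nc_eq0 ->.
  by rewrite eqxx.
have [] := h [set u | nc (cval u - cval z) < nc (cval z - cval w) / 2]
             [set u | nc (cval u - cval w) < nc (cval z - cval w) / 2].
- by apply/nbhs_circleP; exists (nc (cval z - cval w) / 2); rewrite ?divr_gt0.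
- by apply/nbhs_circleP; exists (nc (cval z - cval w) / 2); rewrite ?divr_gt0.
move=> u /= [hz hw].
have := ncD (cval z - cval u) (cval u - cval w); rewrite addrA subrK ncB.
lra.
Qed.

Lemma expiE (t : R) : cval (expi t) = (cos t +i* sin t)%C.
Proof. by []. Qed.

Lemma expiD (s t : R) : cval (expi (s + t)) = cval (expi s) * cval (expi t).
Proof.
by rewrite !expiE cosD sinD; simpc; congr (_ +i* _)%C; ring.
Qed.

Lemma expi0 : cval (expi (0 : R)) = 1.
Proof. by rewrite expiE cos0 sin0. Qed.

Lemma expiMn (t : R) n : cval (expi (t *+ n)) = cval (expi t) ^+ n.
Proof.
by elim: n => [|n IH]; rewrite ?mulr0n ?expi0 // mulrS expiD IH exprS.
Qed.

Lemma expi_surj z : exists2 t : R, 0 <= t <= pi *+ 2 & expi t = z.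
Proof.
have := nc_cval z; case E : (cval z) => [a b] /= h.
have ab : a ^+ 2 + b ^+ 2 = 1.
  by rewrite -[LHS]sqr_sqrtr ?addr_ge0 ?sqr_ge0 // h expr1n.
have a1 : -1 <= a <= 1.
  by have := sqr_ge0 b; have := sqr_ge0 a; rewrite !expr2 in ab *; nra.
have ca : cos (acos a) = a by rewrite acosK // in_itv.
have sa : sin (acos a) = `|b|.
  by rewrite sin_acos // -ab [_ + b ^+ 2]addrC addrK sqrtr_sqr.
have pi0 := pi_ge0 R.
have [b0|b0] := leP 0 b.
  exists (acos a).
    rewrite acos_ge0 //= (le_trans (acos_lepi a1)) //.
    by rewrite mulr2n lerDl.
  by apply: cval_inj; rewrite E expiE ca sa ger0_norm.
exists (pi *+ 2 - acos a).
  have := acos_ge0 a1; have := acos_lepi a1; rewrite mulr2n.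
  by move=> ? ?; apply/andP; split; lra.
apply: cval_inj; rewrite E expiE [pi *+ 2 - _]addrC cosD2pi sinD2pi.
rewrite cosN sinN ca sa.
by rewrite ltr0_norm // opprK.
Qed.

Lemma expi_continuous : continuous (@expi R).
Proof.
move=> t U /nbhs_circleP[e e0 sU].
have e2 : 0 < e / 2 by rewrite divr_gt0.
have := @continuous_cos R t; move/cvgrPdist_lt => /(_ _ e2) hc.
have := @continuous_sin R t; move/cvgrPdist_lt => /(_ _ e2) hs.
apply: (filterS _ (filterI hc hs)) => s /= [h1 h2]; apply: sU.
rewrite (le_lt_trans (nc_le_ReIm _)) // [ltRHS]splitr.
by rewrite !expiE; simpc; rewrite /= ltrD // distrC.
Qed.

Lemma circle_compact : compact [set: circle R].
Proof.
have -> : [set: circle R] = (@expi R) @` (`[0, pi *+ 2]).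
  apply/seteqP; split => z // _; have [t t02 <-] := expi_surj z.
  by exists t => //=; rewrite in_itv.
apply: continuous_compact; last exact: segment_compact.
exact/continuous_subspaceT/expi_continuous.
Qed.

Lemma circle_normal : normal_space (circle R).
Proof. exact: compact_normal circle_hausdorff circle_compact. Qed.

Lemma closed_circle_compact K : closed K -> compact K.
Proof. by move=> cK; exact: subclosed_compact cK circle_compact _. Qed.

Lemma compact_circle_closed K : compact K -> closed K.
Proof. by move=> cK; exact: compact_closed circle_hausdorff cK. Qed.

(** A locally bounded function is bounded above on a compact set. *)
Lemma compact_bounded_above (T : topologicalType) (A : set T) (g : T -> R) :
  compact A -> (forall x, A x -> exists C : R, \forall y \near x, g y <= C) ->
  exists2 C : R, 0 <= C & forall x, A x -> g x <= C.
Proof.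
move=> /compact_near_coveringP cA h.
have := cA R (pinfty_nbhs R) (fun C x => g x <= C) _ _.
move=> []; first by move=> x Ax; have [C hC] := h x Ax; near=> y D => /=;
  apply: (@le_trans _ _ C); [near: y | near: D; apply: nbhs_pinfty_ge; rewrite num_real].
move=> M [Mr hM]; exists (Num.max 0 (M + 1)); first by rewrite le_max lexx.
by move=> x Ax; apply: hM => //; rewrite lt_max ltrDl ltr01 orbT.
Unshelve. all: by end_near. Qed.

(** Heine-Cantor on the circle. *)
Lemma circle_unif_continuous (phi : circle R -> R[i]^o) :
  continuous phi -> forall e : R, 0 < e -> exists2 d : R, 0 < d &
    forall z w, nc (cval w - cval z) < d -> nc (phi w - phi z) < e.
Proof.
move=> /continuous_circleP cphi e e0.
have /compact_near_coveringP cT := circle_compact.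
have := cT R (0^'+) (fun d z => forall w, nc (cval w - cval z) < d ->
  nc (phi w - phi z) < e) _ _.
move=> []; last first.
  move=> d /= d0 h; exists (d / 2); first by rewrite divr_gt0.
  move=> z w zw; apply: (h (d / 2)) => //=; last by rewrite divr_gt0.
  by rewrite sub0r normrN gtr0_norm ?divr_gt0 // ltr_pdivrMr // ltr_pMr // ltr1n.
move=> z _; have e2 : 0 < e / 2 by rewrite divr_gt0.
have [d d0 hd] := cphi z _ e2.
have d2 : 0 < d / 2 by rewrite divr_gt0.
exists ([set w | nc (cval w - cval z) < d / 2], [set s | s < d / 2]); first split.
- by apply/nbhs_circleP; exists (d / 2).
- by apply: nbhs_right_lt.
move=> [w s] /= [wz sd] u uw.
have h1 : nc (phi u - phi z) < e / 2.
  apply: hd; have := ncD (cval u - cval w) (cval w - cval z).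
  by rewrite addrA subrK; lra.
have h2 : nc (phi w - phi z) < e / 2 by apply: hd; lra.
have := ncD (phi u - phi z) (phi z - phi w).
by rewrite addrA subrK [nc (phi z - phi w)]ncB; lra.
Qed.

Lemma continuous_bounded (phi : circle R -> R[i]^o) :
  continuous phi -> exists2 C : R, 0 <= C & forall z, nc (phi z) <= C.
Proof.
move=> /continuous_circleP cphi.
have [] := @compact_bounded_above _ setT (nc \o phi) circle_compact.
  move=> z _; exists (nc (phi z) + 1); apply/nbhs_circleP.
  have [d d0 h] := cphi z 1 ltr01; exists d => // w /h /= hw.
  by have := ncD (phi w - phi z) (phi z); rewrite subrK; lra.
by move=> C C0 h; exists C => // z; exact: h.
Qed.

End circle_topology.

(** * Mean values and Fourier coefficients *)

Section circle_mean.
Context (R : realType).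
Implicit Types (g h : circle R -> R) (phi psi : circle R -> R[i]^o).
Local Notation nc := (@Normc.normc R).
Local Notation mu := (@lebesgue_measure R).
Local Notation I := (`[0, pi *+ 2]%classic : set R).

(** Average of a real function over the circle. *)
Definition rmean g : R :=
  (pi *+ 2)^-1 * (\int[mu]_(t in I) g (expi t)).

(** Average of a complex function over the circle, that is, its Fourier
    coefficient of index 0. *)
Definition cmean phi : R[i]^o :=
  (rmean (fun z => complex.Re (phi z)) +i* rmean (fun z => complex.Im (phi z)))%C.

Lemma fourierE phi k :
  fourier phi k = cmean (fun z => phi z * cval z ^ (- k)).
Proof. by []. Qed.

Lemma pi2_gt0 : 0 < pi *+ 2 :> R.
Proof. by rewrite pmulrn_lgt0 // pi_gt0. Qed.

(** Continuity of a real function on the circle, read through [expi]. *)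
Definition rcont g := continuous (g \o @expi R : R -> R).

Lemma rcont_integrable g : rcont g ->
  mu.-integrable I (EFin \o (g \o @expi R)).
Proof.
move=> cg; apply: continuous_compact_integrable; first exact: segment_compact.
exact: continuous_subspaceT.
Qed.

Lemma rmeanD g h : rcont g -> rcont h ->
  rmean (fun z => g z + h z) = rmean g + rmean h.
Proof.
move=> cg ch; rewrite /rmean -mulrDr; congr (_ * _).
by apply: RintegralD => //; exact: rcont_integrable.
Qed.

Lemma rmeanZ g r : rcont g -> rmean (fun z => r * g z) = r * rmean g.
Proof.
move=> cg; rewrite /rmean mulrCA; congr (_ * _).
by apply: RintegralZl => //; exact: rcont_integrable.
Qed.

Lemma le_rmean g h : rcont g -> rcont h -> (forall z, g z <= h z) ->
  rmean g <= rmean h.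
Proof.
move=> cg ch gh; rewrite /rmean ler_pM2l ?invr_gt0 ?pi2_gt0 //.
by apply: le_Rintegral => //; exact: rcont_integrable.
Qed.

Lemma rmean_cst r : rmean (fun=> r) = r.
Proof.
have E : mu I = (pi *+ 2)%:E.
  by rewrite lebesgue_measure_itv /= lte_fin pi2_gt0 sube0.
rewrite /rmean Rintegral_cst //= E /=.
by rewrite mulrCA mulVf ?mulr1 // gt_eqF // pi2_gt0.
Qed.

Lemma rcontD g h : rcont g -> rcont h -> rcont (fun z => g z + h z).
Proof. by move=> cg ch t; apply: cvgD; [exact: cg|exact: ch]. Qed.

Lemma rcontZ g r : rcont g -> rcont (fun z => r * g z).
Proof. by move=> cg t; apply: cvgM; [exact: cvg_cst|exact: cg]. Qed.

Lemma rcont_cst r : rcont (fun=> r).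
Proof. by move=> t; exact: cvg_cst. Qed.

Lemma rcont_Re phi : continuous phi -> rcont (fun z => complex.Re (phi z)).
Proof.
move=> cphi t; apply/cvgrPdist_lt => e e0.
have c : continuous (phi \o @expi R).
  by move=> s; apply: continuous_comp; [exact: expi_continuous|exact: cphi].
apply: (filterS _ ((@cvgCP R _ (nbhs t) _ _ _).1 (c t) e e0)) => s /= h.
rewrite distrC; apply: le_lt_trans h.
by rewrite -raddfB; exact: Re_le_nc.
Qed.

Lemma rcont_Im phi : continuous phi -> rcont (fun z => complex.Im (phi z)).
Proof.
move=> cphi t; apply/cvgrPdist_lt => e e0.
have c : continuous (phi \o @expi R).
  by move=> s; apply: continuous_comp; [exact: expi_continuous|exact: cphi].
apply: (filterS _ ((@cvgCP R _ (nbhs t) _ _ _).1 (c t) e e0)) => s /= h.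
rewrite distrC; apply: le_lt_trans h.
by rewrite -raddfB; exact: Im_le_nc.
Qed.

Lemma eq_rmean g h : g =1 h -> rmean g = rmean h.
Proof. by move=> /funext ->. Qed.

Lemma cmeanD phi psi : continuous phi -> continuous psi ->
  cmean (fun z => phi z + psi z) = cmean phi + cmean psi.
Proof.
move=> cphi cpsi; rewrite /cmean; simpc; congr (_ +i* _)%C.
  rewrite -rmeanD; [|exact: rcont_Re..].
  by apply: eq_rmean => z; rewrite raddfD.
rewrite -rmeanD; [|exact: rcont_Im..].
by apply: eq_rmean => z; rewrite raddfD.
Qed.

Lemma cmeanZ phi (c : R[i]) : continuous phi ->
  cmean (fun z => c * phi z) = c * cmean phi.
Proof.
case: c => a b cphi; rewrite /cmean; simpc.
have cR := rcont_Re cphi; have cI := rcont_Im cphi.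
have lin p q : rmean (fun z => p * complex.Re (phi z) + q * complex.Im (phi z))
    = p * rmean (fun z => complex.Re (phi z))
      + q * rmean (fun z => complex.Im (phi z)).
  by rewrite rmeanD ?rmeanZ //; exact: rcontZ.
congr (_ +i* _)%C.
  rewrite -mulNr -lin.
  by apply: eq_rmean => z; case: (phi z) => x y; rewrite /= mulNr.
rewrite addrC -lin.
by apply: eq_rmean => z; case: (phi z) => x y /=; rewrite addrC.
Qed.

Lemma continuousMl phi (c : R[i]) :
  continuous phi -> continuous (fun z => c * phi z : R[i]^o).
Proof. move=> cphi z; apply: (@cvgM _ _ (nbhs z) _ (fun=> c : R[i]^o) phi c (phi z)); first exact: cvg_cst.
exact: cphi. Qed.

(** The mean is a positive functional. *)
Lemma nc_cmean_le phi g : continuous phi -> rcont g ->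
  (forall z, nc (phi z) <= g z) -> nc (cmean phi) <= rmean g.
Proof.
move=> cphi cg h; have [m0|m0] := eqVneq (cmean phi) 0.
  rewrite m0 nc0 -[0](rmean_cst 0).
  apply: le_rmean => // [|z]; first exact: rcont_cst.
  exact: le_trans (nc_ge0 _) (h z).
have nm0 : nc (cmean phi) != 0 by apply: contra m0 => /eqP/nc_eq0/eqP.
(* rotate the mean onto the positive half line *)
pose u : R[i] := ((cmean phi)^*)%C * (((nc (cmean phi))^-1)%:C)%C.
have nu : nc u = 1.
  by rewrite ncM nc_conj nc_real ger0_norm ?invr_ge0 ?nc_ge0 // mulfV.
have E : ((nc (cmean phi))%:C)%C = cmean (fun z => u * phi z).
  rewrite cmeanZ // /u mulrAC [_ * cmean phi]mulrC -nc_sqr -real_complexM.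
  by rewrite expr2 mulfK.
have -> : nc (cmean phi) = rmean (fun z => complex.Re (u * phi z)).
  by have := congr1 (@complex.Re R) E.
apply: le_rmean => // [|z]; first exact/rcont_Re/continuousMl.
apply: (le_trans (ler_norm _)); apply: (le_trans (Re_le_nc _)).
by rewrite ncM nu mul1r.
Qed.

(** The derivative of a periodic function has mean zero. *)
Lemma Rintegral_derive_periodic (F f : R -> R) :
  (forall t : R, is_derive t 1 F (f t)) -> continuous f ->
  F 0 = F (pi *+ 2) -> \int[mu]_(t in I) f t = 0.
Proof.
move=> dF cf FE.
have cF : continuous F.
  by move=> t; apply/differentiable_continuous/derivable1_diffP; case: (dF t).
rewrite /Rintegral (@continuous_FTC2 _ _ F) ?pi2_gt0 //=.
- by rewrite FE subrr.
- exact: continuous_subspaceT.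
- split.
  + by move=> t _; case: (dF t).
  + exact/cvg_at_right_filter/cF.
  + exact/cvg_at_left_filter/cF.
- by move=> t _; rewrite derive1E; case: (dF t).
Qed.

Lemma cos_sin_2kpi (k : nat) :
  cos (k%:R * (pi *+ 2)) = 1 :> R /\ sin (k%:R * (pi *+ 2)) = 0 :> R.
Proof.
elim: k => [|k [IHc IHs]]; first by rewrite mul0r cos0 sin0.
by rewrite -natr1 mulrDl mul1r cosD2pi sinD2pi.
Qed.

Lemma continuous_mul_arg (f : R -> R) (k : R) :
  continuous f -> continuous (fun t => f (k * t)).
Proof.
move=> cf t; apply: (@continuous_comp _ _ _ (fun t => k * t) f); last exact: cf.
by apply: cvgM; [exact: cvg_cst|exact: cvg_id].
Qed.

Lemma is_derive_mul_arg (f : R -> R) (k t l : R) : is_derive (k * t) 1 f l ->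
  is_derive t 1 (fun t => f (k * t)) (k * l).
Proof.
move=> df; rewrite mulrC.
have dk : is_derive t 1 ( *%R k : R -> R) k.
  by apply: is_derive_eq; rewrite /GRing.scale /= mulr1.
exact: (is_derive1_comp df dk).
Qed.

Lemma mean_cos_sin (k : nat) : (0 < k)%N ->
  \int[mu]_(t in I) cos (k%:R * t) = 0 :> R /\
  \int[mu]_(t in I) sin (k%:R * t) = 0 :> R.
Proof.
move=> k0; have kn0 : k%:R != 0 :> R by rewrite pnatr_eq0 -lt0n.
have [c2 s2] := cos_sin_2kpi k; split.
- apply: (@Rintegral_derive_periodic (fun t => k%:R^-1 * sin (k%:R * t))).
  + move=> t; apply: (is_derive_eq (is_deriveZ _ (is_derive_mul_arg (is_derive_sin _)))).
    by rewrite /GRing.scale /= mulKf.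
  + by apply: continuous_mul_arg; exact: continuous_cos.
  + by rewrite s2 mulr0 sin0.
- apply: (@Rintegral_derive_periodic (fun t => - k%:R^-1 * cos (k%:R * t))).
  + move=> t; apply: (is_derive_eq (is_deriveZ _ (is_derive_mul_arg (is_derive_cos _)))).
    by rewrite /GRing.scale /= mulrN mulrNN mulKf.
  + by apply: continuous_mul_arg; exact: continuous_sin.
  + by rewrite c2 mulr0 cos0.
Qed.

Lemma cmean_expX (k : nat) : cmean (fun z => cval z ^+ k) = (k == 0%N)%:R.
Proof.
case: k => [|k].
  rewrite /cmean /=.
  by rewrite (rmean_cst 1) (rmean_cst 0).
have E (t : R) : cval (expi t) ^+ k.+1 =
    (cos (k.+1%:R * t) +i* sin (k.+1%:R * t))%C.
  by rewrite -expiMn mulr_natl.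
have [hc hs] := @mean_cos_sin k.+1 isT.
rewrite /cmean /rmean.
under eq_Rintegral do rewrite E /=.
rewrite hc mulr0.
under eq_Rintegral do rewrite E /=.
by rewrite hs mulr0.
Qed.

Lemma cmean_conj phi : continuous phi ->
  cmean (fun z => ((phi z)^*)%C) = ((cmean phi)^*)%C.
Proof.
move=> cphi; rewrite /cmean /=; congr (_ +i* _)%C.
  by apply: eq_rmean => z; case: (phi z).
rewrite -mulN1r -rmeanZ; last exact: rcont_Im.
by apply: eq_rmean => z; rewrite mulN1r; case: (phi z).
Qed.

Lemma continuous_const (c : R[i]) : continuous (fun _ : circle R => c : R[i]^o).
Proof.
by apply/continuous_circleP => z e e0; exists e => // w _; rewrite subrr nc0.
Qed.

Lemma continuous_cvalX (n : nat) : continuous (fun z => cval z ^+ n : R[i]^o).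
Proof.
have c1 : continuous (fun z => cval z : R[i]^o).
  by apply/continuous_circleP => z e e0; exists e.
elim: n => [|n IH] z.
  exact: (@continuous_const 1).
rewrite (_ : (fun z => _) = (fun z => cval z * cval z ^+ n : R[i]^o)).
  by apply: (@cvgM _ _ (nbhs z)); [exact: c1|exact: IH].
by apply/funext => w; rewrite exprS.
Qed.

Lemma continuous_conj phi :
  continuous phi -> continuous (fun z => ((phi z)^*)%C : R[i]^o).
Proof.
move=> /continuous_circleP cphi; apply/continuous_circleP => z e e0.
have [d d0 h] := cphi z e e0; exists d => // w /h.
by rewrite -raddfB nc_conj.
Qed.

Lemma cval_conjX (n : nat) (z : circle R) :
  ((cval z ^+ n)^*)%C = cval z ^ (- n%:Z).
Proof. by rewrite rmorphXn /= cval_conj -exprz_inv exprnP. Qed.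

Lemma continuous_cvalXz (k : int) : continuous (fun z => cval z ^ k : R[i]^o).
Proof.
case: k => n; first exact: continuous_cvalX.
have := continuous_conj (@continuous_cvalX n.+1).
by under eq_fun do rewrite cval_conjX.
Qed.

(** Orthogonality of the characters. *)
Lemma cmean_expXz (k : int) : cmean (fun z => cval z ^ k) = (k == 0)%:R.
Proof.
case: k => n; first exact: cmean_expX.
have := cmean_conj (@continuous_cvalX n.+1).
under eq_fun do rewrite cval_conjX.
by move=> ->; rewrite cmean_expX conjc0.
Qed.

End circle_mean.

(** * Geometric decay and central binomial coefficients *)

Section geometric_decay.
Context (R : realType).

(** A linear factor does not spoil geometric decay. *)
Lemma linear_geometric_le (q : R) : 0 <= q < 1 ->
  exists C r : R, [/\ 0 <= C, 0 <= r < 1 & forall n, n.+1%:R * q ^+ n <= C * r ^+ n].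
Proof.
(* for [r^2 = q], [(n + 1) r^n] is at most a geometric sum of ratio [r] *)
move=> /andP[q0 q1]; pose r := Num.sqrt q.
have r0 : 0 <= r by exact: sqrtr_ge0.
have rq : r ^+ 2 = q by rewrite sqr_sqrtr.
have r1 : r < 1 by rewrite -(@ltr_pXn2r _ 2) ?nnegrE // rq expr1n.
have r10 : 0 < 1 - r by rewrite subr_gt0.
have hn n : n.+1%:R * r ^+ n <= (1 - r)^-1.
  rewrite -[leRHS]mul1r ler_pdivlMr //.
  have h : n.+1%:R * r ^+ n <= \sum_(i < n.+1) r ^+ i.
    rewrite mulr_natl -[X in _ *+ X]card_ord -sumr_const; apply: ler_sum => i _.
    by rewrite ler_wiXn2l ?ltnS // ?ltW // -ltnS.
  apply: (le_trans (ler_wpM2r (ltW r10) h)).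
  rewrite mulrC -opprB mulNr -subrX1 opprB lerBlDr lerDl.
  exact: exprn_ge0.
exists (1 - r)^-1, r; split; rewrite ?r0 ?r1 ?invr_ge0 ?ltW // => n.
rewrite -rq -exprM mulnC exprM expr2 mulrA.
by apply: ler_wpM2r; rewrite ?exprn_ge0.
Qed.

Lemma geometric_small (C r e : R) : 0 <= r < 1 -> 0 < e ->
  exists N, forall n, (N <= n)%N -> C * r ^+ n < e.
Proof.
move=> /andP[r0 r1] e0.
have r1' : `|r| < 1 by rewrite ger0_norm.
have /cvgrPdist_lt /(_ e e0) [N _ hN] := cvg_geometric C r1'.
exists N => n /hN /=; rewrite sub0r normrN => /(le_lt_trans _); apply.
exact: ler_norm.
Qed.

End geometric_decay.

Lemma leq_bin_central n j : ('C(n + n, j) <= 'C(n + n, n))%N.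
Proof.
have up k : (k <= n)%N -> ('C(n + n, n - k) <= 'C(n + n, n))%N.
  elim: k => [|k IH] kn; first by rewrite subn0.
  apply: leq_trans (IH (ltnW kn)); set m := (n - k.+1)%N.
  have -> : (n - k = m.+1)%N by rewrite /m; lia.
  have := mul_bin_left (n + n) m.
  have h : (m.+1 <= n + n - m)%N by rewrite /m; lia.
  move=> E; rewrite -(leq_pmul2l (ltn0Sn m)) E leq_mul2r h orbT //.
have [jn|nj] := leqP j n; first by rewrite -{1}(subKn jn); apply: up; exact: leq_subr.
have [j2|j2] := leqP j (n + n); last by rewrite bin_small.
rewrite -(bin_sub j2).
have -> : (n + n - j = n - (j - n))%N by lia.
by apply: up; lia.
Qed.

Lemma exp4_le_bin_central n : (4 ^ n <= (n + n).+1 * 'C(n + n, n))%N.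
Proof.
have -> : (4 ^ n = (1 + 1) ^ (n + n))%N by rewrite [(n + n)%N]addnn -mul2n expnM.
rewrite Pascal; under eq_bigr do rewrite !exp1n !muln1.
apply: (@leq_trans (\sum_(i < (n + n).+1) 'C(n + n, n))).
  by apply: leq_sum => i _; exact: leq_bin_central.
by rewrite sum_nat_const card_ord.
Qed.

(** * Trigonometric polynomials *)

Section trigonometric_polynomials.
Context (R : realType).
Implicit Types (phi psi : circle R -> R[i]^o) (s : seq (R[i] * int)).
Local Notation nc := (@Normc.normc R).

(** Trigonometric polynomials, given by a list of coefficients and frequencies
    in which a frequency may occur several times. *)
Definition tpoly s (z : circle R) : R[i]^o :=
  \sum_(x <- s) x.1 * cval z ^ x.2.

Definition tpoly_norm s : R := \sum_(x <- s) nc x.1.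

Lemma tpoly_norm_ge0 s : 0 <= tpoly_norm s.
Proof. by apply: sumr_ge0 => x _; exact: nc_ge0. Qed.

Lemma tpoly_le s z : nc (tpoly s z) <= tpoly_norm s.
Proof.
apply: le_trans (nc_sum _ _ _) _; apply: ler_sum => x _.
by rewrite ncM nc_cvalXz mulr1.
Qed.

Lemma continuous_add phi psi : continuous phi -> continuous psi ->
  continuous (fun z => phi z + psi z : R[i]^o).
Proof.
by move=> cphi cpsi z; apply: (@cvgD _ _ _ (nbhs z)); [exact: cphi|exact: cpsi].
Qed.

Lemma continuous_mul phi psi : continuous phi -> continuous psi ->
  continuous (fun z => phi z * psi z : R[i]^o).
Proof.
by move=> cphi cpsi z; apply: (@cvgM _ _ (nbhs z)); [exact: cphi|exact: cpsi].
Qed.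

Lemma continuous_sum (I : Type) (r : seq I) (F : I -> circle R -> R[i]^o) :
  (forall i, continuous (F i)) ->
  continuous (fun z => \sum_(i <- r) F i z : R[i]^o).
Proof.
move=> cF; elim: r => [|i r IH].
  rewrite (_ : (fun z => _) = (fun=> 0)); first exact: continuous_const.
  by apply/funext => z; rewrite big_nil.
rewrite (_ : (fun z => _) = (fun z => F i z + \sum_(i <- r) F i z)).
  exact: continuous_add (cF i) IH.
by apply/funext => z; rewrite big_cons.
Qed.

Lemma continuous_sub phi psi : continuous phi -> continuous psi ->
  continuous (fun z => phi z - psi z : R[i]^o).
Proof.
by move=> cphi cpsi z; apply: (@cvgB _ _ _ (nbhs z)); [exact: cphi|exact: cpsi].
Qed.

Lemma cmeanB phi psi : continuous phi -> continuous psi ->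
  cmean (fun z => phi z - psi z) = cmean phi - cmean psi.
Proof.
move=> cphi cpsi.
have -> : - cmean psi = cmean (fun z => -1 * psi z) by rewrite cmeanZ // mulN1r.
rewrite -(cmeanD cphi (continuousMl (c := -1) cpsi)).
by congr cmean; apply/funext => z; rewrite mulN1r.
Qed.

Lemma cmean_sum (I : Type) (r : seq I) (F : I -> circle R -> R[i]^o) :
  (forall i, continuous (F i)) ->
  cmean (fun z => \sum_(i <- r) F i z) = \sum_(i <- r) cmean (F i).
Proof.
move=> cF; elim: r => [|i r IH].
  rewrite big_nil (_ : (fun z => _) = (fun z => 0 * 1)).
    by rewrite cmeanZ ?mul0r //; exact: continuous_const.
  by apply/funext => z; rewrite big_nil mul0r.
rewrite big_cons -IH -(cmeanD (cF i) (@continuous_sum _ r F cF)).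
by congr cmean; apply/funext => z; rewrite big_cons.
Qed.

Lemma continuous_tpoly s : continuous (tpoly s).
Proof.
apply: (@continuous_sum _ s (fun x z => x.1 * cval z ^ x.2)) => x.
exact/continuousMl/continuous_cvalXz.
Qed.

Lemma fourier_tpoly s k : fourier (tpoly s) k = \sum_(x <- s | x.2 == k) x.1.
Proof.
rewrite fourierE /tpoly.
rewrite (_ : (fun z => _) = (fun z => \sum_(x <- s) x.1 * cval z ^ (x.2 - k))).
  rewrite (@cmean_sum _ s (fun x z => x.1 * cval z ^ (x.2 - k))); last first.
    by move=> x; exact/continuousMl/continuous_cvalXz.
  rewrite [RHS]big_mkcond; apply: eq_bigr => x _.
  rewrite cmeanZ; last exact: continuous_cvalXz.
  by rewrite cmean_expXz subr_eq0; case: eqP; rewrite ?mulr1 ?mulr0.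
apply/funext => z; rewrite mulr_suml; apply: eq_bigr => x _.
by rewrite -mulrA -expfzDr ?cval_neq0.
Qed.

Lemma continuous_char phi k :
  continuous phi -> continuous (fun z => phi z * cval z ^ k : R[i]^o).
Proof. by move=> cphi; exact/continuous_mul/continuous_cvalXz. Qed.

Lemma fourier_near phi psi (e : R) k : continuous phi -> continuous psi ->
  (forall z, nc (phi z - psi z) <= e) -> nc (fourier phi k - fourier psi k) <= e.
Proof.
move=> cphi cpsi h; rewrite !fourierE.
have -> : cmean (fun z => phi z * cval z ^ (- k))
      - cmean (fun z => psi z * cval z ^ (- k))
    = cmean (fun z => (phi z - psi z) * cval z ^ (- k)).
  rewrite -cmeanB; [|exact: continuous_char..].
  by congr cmean; apply/funext => z; rewrite mulrBl.
rewrite -[leRHS](rmean_cst e); apply: nc_cmean_le.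
- exact/continuous_char/continuous_sub.
- exact: rcont_cst.
- by move=> z; rewrite ncM nc_cvalXz mulr1.
Qed.

(** [wball C phi] says that [phi] is a uniform limit of trigonometric
    polynomials of norm at most [C].  This describes the closed ball of radius
    [C] in the Wiener algebra, and has the advantage that finite sums suffice to
    establish its closure properties. *)
Definition wball (C : R) phi := forall e : R, 0 < e ->
  exists s, tpoly_norm s <= C /\ forall z, nc (phi z - tpoly s z) <= e.

Lemma wball_continuous C phi : wball C phi -> continuous phi.
Proof.
move=> h; apply/continuous_circleP => z e e0.
have e4 : 0 < e / 4 by rewrite divr_gt0.
have [s [_ hs]] := h _ e4.
have [d d0 hd] := (continuous_circleP _).1 (@continuous_tpoly s) z _ e4.
exists d => // w /hd hw.
have -> : phi w - phi z = (phi w - tpoly s w) + ((tpoly s w - tpoly s z)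
  - (phi z - tpoly s z)) by ring.
apply: (le_lt_trans (ncD _ _)).
apply: (@le_lt_trans _ _ (e / 4 + (e / 4 + e / 4))); last by move: e0; clear; lra.
apply: lerD (hs w) _; apply: (le_trans (ncD _ _)).
by rewrite ncN; apply: lerD (hs z); exact: ltW.
Qed.

Lemma wball_wiener C phi : wball C phi -> wiener phi /\ (norm1 phi <= C%:E)%E.
Proof.
move=> h; have cphi := wball_continuous h.
suff H : (norm1 phi <= C%:E)%E by split=> //; split=> //; exact: le_lt_trans H (ltry _).
apply: ge_ereal_sup => _ [A [fA _] <-].
rewrite fsbig_finite //= sumEFin lee_fin.
have := finmap.fset_uniq (fset_set A); move: (finmap.enum_fset _) => r ur.
apply/ler_addgt0Pr => e e0; pose d := e / (size r).+1%:R.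
have d0 : 0 < d by rewrite divr_gt0.
have [s [sC hs]] := h _ d0.
have h1 : \sum_(k <- r) nc (fourier phi k) <=
    \sum_(k <- r) (nc (fourier (tpoly s) k) + d).
  apply: ler_sum => k _; rewrite -lerBlDl.
  have := fourier_near k cphi (@continuous_tpoly s) hs; apply: le_trans.
  have := ncD (fourier phi k - fourier (tpoly s) k) (fourier (tpoly s) k).
  by rewrite subrK; lra.
apply: (le_trans h1); rewrite big_split /=; apply: lerD.
  apply: le_trans sC.
  have h2 : \sum_(k <- r) nc (fourier (tpoly s) k) <=
      \sum_(k <- r) \sum_(x <- s | x.2 == k) nc x.1.
    by apply: ler_sum => k _; rewrite fourier_tpoly; exact: nc_sum.
  apply: (le_trans h2); rewrite (exchange_big_dep xpredT) //=.
  apply: ler_sum => x _; rewrite -big_filter.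
  have -> : [seq k <- r | x.2 == k] = if x.2 \in r then [:: x.2] else [::].
    rewrite -(@eq_filter _ (pred1 x.2)); last by move=> k /=; rewrite eq_sym.
    have [xr|xr] := boolP (x.2 \in r); first exact: filter_pred1_uniq.
    by apply/eqP; rewrite -(negbK (_ == _)) -has_filter has_pred1.
  by case: ifP => _; rewrite ?big_cons !big_nil ?addr0 ?nc_ge0.
rewrite big_const_seq count_predT iter_addr_0 -mulr_natr /d.
rewrite -mulrA ler_piMr ?(ltW e0) // [_^-1 * _]mulrC ler_pdivrMr // mul1r ler_nat.
exact: leqnSn.
Qed.

End trigonometric_polynomials.

(** * Fourier inversion *)

Section fejer_kernel.
Context (R : realType).
Implicit Types (phi psi : circle R -> R[i]^o).
Local Notation nc := (@Normc.normc R).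

(** Coefficients of the kernel below, indexed by [j <= 2n] for the frequency
    [j - n]. *)
Definition kcoef n j : R := 'C(n + n, j)%:R / 'C(n + n, n)%:R.

(** The trigonometric kernel [(1 + u)^(2n) / (C(2n, n) u^n)]: it is
    non-negative on the circle, has mean 1 and coefficients between 0 and 1, and
    concentrates at 1. *)
Definition kernel n (u : R[i]) : R[i] :=
  \sum_(j < (n + n).+1) ((kcoef n j)%:C)%C * u ^ (j%:Z - n%:Z).

Lemma bin_central_gt0 n : 0 < 'C(n + n, n)%:R :> R.
Proof. by rewrite ltr0n bin_gt0 leq_addr. Qed.

Lemma kcoef_ge0 n j : 0 <= kcoef n j.
Proof. by rewrite /kcoef divr_ge0. Qed.

Lemma kcoef_le1 n j : kcoef n j <= 1.
Proof.
by rewrite /kcoef ler_pdivrMr ?bin_central_gt0 // mul1r ler_nat leq_bin_central.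
Qed.

Lemma real_complex_nat k : ((k%:R : R)%:C)%C = k%:R :> R[i].
Proof. exact: rmorph_nat. Qed.

Lemma real_complexX (r : R) k : ((r ^+ k)%:C)%C = ((r%:C)%C) ^+ k :> R[i].
Proof. exact: rmorphXn. Qed.

Lemma conjD1 (u : R[i]) : ((1 + u)^*)%C = 1 + (u^*)%C.
Proof. by rewrite (rmorphD (@conjc R)) rmorph1. Qed.

Lemma conj_unit (u : R[i]) : nc u = 1 -> (u^*)%C = u^-1.
Proof.
move=> u1; have u0 : u != 0.
  by apply/eqP => h; move: u1; rewrite h nc0 => /eqP; rewrite eq_sym oner_eq0.
by apply: (mulfI u0); rewrite -nc_sqr u1 expr1n divff.
Qed.

Lemma kernelE n (u : R[i]) : nc u = 1 ->
  kernel n u = (((nc (1 + u) ^+ 2) ^+ n / 'C(n + n, n)%:R)%:C)%C.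
Proof.
move=> u1; have u0 : u != 0.
  by apply/eqP => h; move: u1; rewrite h nc0 => /eqP; rewrite eq_sym oner_eq0.
apply: (mulfI (expf_neq0 n u0)).
have -> : u ^+ n * kernel n u =
    (('C(n + n, n)%:R^-1)%:C)%C * (1 + u) ^+ (n + n).
  rewrite exprDn !mulr_sumr; apply: eq_bigr => j _.
  rewrite expr1n mul1r mulrCA [u ^+ n]exprnP -expfzDr //.
  have -> : (n%:Z + (j%:Z - n%:Z)) = j%:Z by rewrite addrC subrK.
  rewrite -exprnP /kcoef real_complexM real_complex_nat -[u ^+ j *+ _]mulr_natl.
  ring.
rewrite real_complexM mulrA [RHS]mulrC; congr (_ * _).
rewrite real_complexX nc_sqr conjD1 conj_unit //.
have -> : (1 + u) * (1 + u^-1) = (1 + u) ^+ 2 / u by field.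
by rewrite expr_div_n -exprM mul2n -addnn mulrC mulfVK // expf_neq0.
Qed.

Lemma parallelogram (u : R[i]) : nc u = 1 -> nc (1 + u) ^+ 2 = 4 - nc (1 - u) ^+ 2.
Proof.
case: u => a b /= h.
have ab : a ^+ 2 + b ^+ 2 = 1.
  by rewrite -[LHS]sqr_sqrtr ?addr_ge0 ?sqr_ge0 // h expr1n.
rewrite !sqr_sqrtr ?addr_ge0 ?sqr_ge0 //.
rewrite !expr2 in ab *; nra.
Qed.

(** At distance at least [d] from 1 the kernel is at most
    [(2n + 1) (1 - d^2 / 4)^n]. *)
Lemma kernel_tail n (u : R[i]) (d : R) : nc u = 1 -> 0 <= d -> d <= nc (1 - u) ->
  nc (kernel n u) <= (n + n).+1%:R * ((4 - d ^+ 2) / 4) ^+ n.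
Proof.
move=> u1 d0 du; rewrite kernelE // nc_real ger0_norm; last first.
  by rewrite divr_ge0 // exprn_ge0 // exprn_ge0 // nc_ge0.
rewrite ler_pdivrMr ?bin_central_gt0 //.
have le1 : nc (1 + u) ^+ 2 <= 4 - d ^+ 2.
  by rewrite parallelogram // lerD2l lerN2 ler_pXn2r ?nnegrE ?nc_ge0.
have d4 : 0 <= 4 - d ^+ 2 by apply: le_trans le1; rewrite exprn_ge0 // nc_ge0.
apply: (@le_trans _ _ ((4 - d ^+ 2) ^+ n)).
  by rewrite lerXn2r ?nnegrE // exprn_ge0 // nc_ge0.
have -> : (n + n).+1%:R * ((4 - d ^+ 2) / 4) ^+ n * 'C(n + n, n)%:R =
   (4 - d ^+ 2) ^+ n * (((n + n).+1 * 'C(n + n, n))%:R / 4 ^+ n) :> R.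
  by rewrite expr_div_n natrM; ring.
rewrite ler_peMr ?exprn_ge0 // ler_pdivlMr ?exprn_gt0 // mul1r.
by rewrite -natrX ler_nat exp4_le_bin_central.
Qed.

Section inversion.
Variables (phi : circle R -> R[i]^o).
Hypothesis cphi : continuous phi.

(** The convolution of [phi] with the kernel, a trigonometric polynomial. *)
Definition kmean n : seq (R[i] * int) :=
  [seq (((kcoef n j)%:C)%C * fourier phi (j%:Z - n%:Z), j%:Z - n%:Z)
   | j <- iota 0 (n + n).+1].

Lemma sum_iota_ord (T : nmodType) (N : nat) (F : nat -> T) :
  \sum_(j <- iota 0 N) F j = \sum_(j < N) F j.
Proof. by rewrite -(big_mkord xpredT) /index_iota subn0. Qed.

Lemma continuous_kernel n (z : circle R) :
  continuous (fun w => kernel n (cval z * (cval w)^-1) : R[i]^o).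
Proof.
apply: (@continuous_sum R _ _ (fun j w => ((kcoef n (j : 'I__))%:C)%C *
  (cval z * (cval w)^-1) ^ (j%:Z - n%:Z))) => j.
apply: continuousMl.
rewrite (_ : (fun w => _) = (fun w => cval z ^ (j%:Z - n%:Z) *
   cval w ^ (- (j%:Z - n%:Z)) : R[i]^o)).
  exact/continuousMl/continuous_cvalXz.
by apply/funext => w; rewrite expfzMl exprz_inv.
Qed.

(** [kmean n] is the mean of [phi] against the translated kernel. *)
Lemma kmeanE n z :
  tpoly (kmean n) z = cmean (fun w => phi w * kernel n (cval z * (cval w)^-1)).
Proof.
rewrite /tpoly /kmean big_map sum_iota_ord.
pose G (j : 'I_(n + n).+1) w : R[i]^o :=
  (((kcoef n j)%:C)%C * cval z ^ (j%:Z - n%:Z)) *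
  (phi w * cval w ^ (- (j%:Z - n%:Z))).
have cG j : continuous (G j) by exact/continuousMl/continuous_char.
rewrite (_ : (fun w => _) = (fun w => \sum_(j < (n + n).+1) G j w)); last first.
  apply/funext => w; rewrite mulr_sumr; apply: eq_bigr => j _.
  by rewrite /G expfzMl exprz_inv; ring.
rewrite cmean_sum //; apply: eq_bigr => j _.
rewrite cmeanZ; last exact: continuous_char.
by rewrite -fourierE /= mulrAC.
Qed.

Lemma cmean_kernel n z : cmean (fun w => kernel n (cval z * (cval w)^-1)) = 1.
Proof.
pose G (j : 'I_(n + n).+1) w : R[i]^o :=
  (((kcoef n j)%:C)%C * cval z ^ (j%:Z - n%:Z)) * cval w ^ (- (j%:Z - n%:Z)).
have cG j : continuous (G j) by exact/continuousMl/continuous_cvalXz.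
rewrite (_ : (fun w => _) = (fun w => \sum_(j < (n + n).+1) G j w)); last first.
  apply/funext => w; apply: eq_bigr => j _.
  by rewrite /G expfzMl exprz_inv; ring.
rewrite cmean_sum //.
have nlt : (n < (n + n).+1)%N by rewrite ltnS leq_addr.
rewrite (bigD1 (Ordinal nlt)) //= big1 ?addr0.
  rewrite cmeanZ; last exact: continuous_cvalXz.
  rewrite cmean_expXz subrr oppr0 eqxx mulr1 expr0z mulr1 /kcoef divff //.
  by rewrite gt_eqF // bin_central_gt0.
move=> j jn; rewrite cmeanZ; last exact: continuous_cvalXz.
rewrite cmean_expXz oppr_eq0 subr_eq0 eqz_nat.
have -> : (nat_of_ord j == n) = false.
  by apply: contraNF jn => /eqP jn; apply/eqP/val_inj.
by rewrite mulr0.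
Qed.

Lemma kmean_norm_le n : tpoly_norm (kmean n) <=
  \sum_(j < (n + n).+1) nc (fourier phi (j%:Z - n%:Z)).
Proof.
rewrite /tpoly_norm big_map sum_iota_ord; apply: ler_sum => j _.
rewrite -[leLHS]/(nc (((kcoef n j)%:C)%C * fourier phi (j%:Z - n%:Z))).
rewrite ncM nc_real ger0_norm ?kcoef_ge0 //.
by rewrite ler_piMl ?nc_ge0 // kcoef_le1.
Qed.

(** The convolutions converge uniformly to [phi]. *)
Lemma kmean_cvg (e : R) : 0 < e ->
  exists n, forall z, nc (phi z - tpoly (kmean n) z) <= e.
Proof.
move=> e0; have e2 : 0 < e / 2 by rewrite divr_gt0.
have [C C0 hC] := continuous_bounded cphi.
have [d d0 hd] := circle_unif_continuous cphi e2.
pose d1 : R := Num.min d 1.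
have d10 : 0 < d1 by rewrite /d1 lt_min d0 ltr01.
have d1d : d1 <= d by rewrite /d1 ge_min lexx.
have d11 : d1 <= 1 by rewrite /d1 ge_min lexx orbT.
pose q : R := (4 - d1 ^+ 2) / 4.
have d12 : 0 < d1 ^+ 2 <= 1 by rewrite exprn_gt0 //= expr_le1 // ltW.
have q01 : 0 <= q < 1 by rewrite /q; move: d12 => /andP[? ?]; apply/andP; split; lra.
have [D [r [D0 r01 hr]]] := linear_geometric_le q01.
have [N hN] := geometric_small (4 * C * D) r01 e2.
exists N => z.
pose K w : R[i]^o := kernel N (cval z * (cval w)^-1).
have cK : continuous K by exact: continuous_kernel.
have cpK : continuous (fun w => phi w * K w : R[i]^o) by exact: continuous_mul.
have czK : continuous (fun w => phi z * K w : R[i]^o) by exact: continuousMl.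
have K1 : cmean K = 1 by exact: cmean_kernel.
have -> : phi z - tpoly (kmean N) z = cmean (fun w => phi z * K w - phi w * K w).
  rewrite (cmeanB czK cpK) (cmeanZ _ cK) K1 mulr1; congr (_ - _).
  exact: kmeanE.
pose T : R := 2 * C * ((N + N).+1%:R * q ^+ N).
have KE w : K w = ((complex.Re (K w))%:C)%C /\ 0 <= complex.Re (K w).
  rewrite /K kernelE /=; first by split=> //; rewrite divr_ge0 // !exprn_ge0 // nc_ge0.
  by rewrite ncM ncV !nc_cval invr1 mulr1.
have cR : rcont (fun w => e / 2 * complex.Re (K w)) by exact/rcontZ/rcont_Re.
have T0 : 0 <= T by rewrite /T !mulr_ge0 // exprn_ge0 //; case/andP: q01.
apply: (@le_trans _ _ (rmean (fun w => e / 2 * complex.Re (K w) + T))).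
  apply: nc_cmean_le.
  - exact: continuous_sub.
  - by apply: rcontD => //; exact: rcont_cst.
  - move=> w; rewrite -mulrBl ncM; have [KR K0] := KE w.
    have nK : nc (K w) = complex.Re (K w) by rewrite KR nc_real ger0_norm.
    have [zw|zw] := ltP (nc (cval z - cval w)) d.
      apply: (@le_trans _ _ (e / 2 * complex.Re (K w))); last by rewrite lerDl.
      by rewrite nK ler_wpM2r // ltW // hd.
    apply: (@le_trans _ _ T); last by rewrite lerDr mulr_ge0 // ltW.
    rewrite /T; apply: ler_pM; rewrite ?nc_ge0 //.
      apply: le_trans (ncD _ _) _; rewrite ncN.
      by have := hC z; have := hC w; lra.
    apply: kernel_tail; first by rewrite ncM ncV !nc_cval invr1 mulr1.
      exact: ltW.
    apply: (le_trans d1d); apply: (le_trans zw).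
    have -> : cval z - cval w = - (1 - cval z * (cval w)^-1) * cval w.
      by rewrite opprB mulrBl mul1r mulfVK // cval_neq0.
    by rewrite ncM nc_cval mulr1 ncN.
rewrite rmeanD //; last exact: rcont_cst.
rewrite rmean_cst rmeanZ; last exact: rcont_Re.
have -> : rmean (fun w => complex.Re (K w)) = 1.
  by have := congr1 (@complex.Re R) K1.
rewrite mulr1 [leRHS]splitr lerD2l; apply: ltW; apply: le_lt_trans (hN N (leqnn N)).
rewrite /T; have [/andP[r0 _] /andP[q0 _]] := (r01, q01).
have h1 : (N + N).+1%:R * q ^+ N <= 2 * (D * r ^+ N).
  apply: le_trans (ler_wpM2l _ (hr N)); rewrite // mulrA.
  apply: ler_wpM2r; first exact: exprn_ge0.
  by rewrite -natrM ler_nat mul2n -addnn addSn addnS ltnS leqnSn.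
apply: (le_trans (ler_wpM2l _ h1)); first by rewrite mulr_ge0.
by rewrite le_eqVlt; apply/orP; left; apply/eqP; ring.
Qed.

End inversion.

(** Fourier inversion: a Wiener function lies in the ball of its own norm. *)
Lemma wiener_wball phi C : wiener phi -> (norm1 phi <= C%:E)%E -> wball C phi.
Proof.
move=> [cphi _] nC e e0; have [n hn] := kmean_cvg cphi e0.
exists (kmean phi n); split => //; apply: (le_trans (kmean_norm_le _ _)).
rewrite -lee_fin; apply: le_trans nC.
pose r : seq int := [seq j%:Z - n%:Z | j <- iota 0 (n + n).+1].
have ur : uniq r by rewrite map_inj_uniq ?iota_uniq // => i j /addIr [].
rewrite -(sum_iota_ord _ (fun j => nc (fourier phi (j%:Z - n%:Z)))).
rewrite -sumEFin -(big_map (fun j => j%:Z - n%:Z) xpredT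
  (fun k => (nc (fourier phi k))%:E)) -/r fsbig_seq //.
apply: esum_ge; exists [set` r] => //.
by split => //; exact: finite_seq.
Qed.

End fejer_kernel.

(** * Closure properties of the balls of the Wiener algebra *)

Section wiener_algebra.
Context (R : realType).
Implicit Types (phi psi : circle R -> R[i]^o) (C D e : R).
Local Notation nc := (@Normc.normc R).

Lemma wball_ge0 C phi : wball C phi -> 0 <= C.
Proof.
by move=> /(_ 1 ltr01) [s [sC _]]; exact: le_trans (tpoly_norm_ge0 s) sC.
Qed.

Lemma wball_le C phi z : wball C phi -> nc (phi z) <= C.
Proof.
move=> h; apply/ler_addgt0Pr => e e0; have [s [sC hs]] := h e e0.
have := ncD (phi z - tpoly s z) (tpoly s z); rewrite subrK.
by have := hs z; have := tpoly_le s z; lra.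
Qed.

Lemma wball_mono C D phi : C <= D -> wball C phi -> wball D phi.
Proof.
by move=> CD h e /h[s [sC hs]]; exists s; split => //; exact: le_trans CD.
Qed.

Lemma wball_tpoly (s : seq (R[i] * int)) : wball (tpoly_norm s) (tpoly s).
Proof. by move=> e e0; exists s; split => // z; rewrite subrr nc0 ltW. Qed.

Lemma eq_wball C phi psi : phi =1 psi -> wball C phi -> wball C psi.
Proof. by move=> /funext ->. Qed.

Lemma wball_char (c : R[i]) (k : int) : wball (nc c) (fun z => c * cval z ^ k).
Proof.
have := wball_tpoly [:: (c, k)].
rewrite /tpoly_norm big_seq1; apply: eq_wball => z.
by rewrite /tpoly big_seq1.
Qed.

Lemma wball_cst (c : R[i]) : wball (nc c) (fun=> c).
Proof. by apply: eq_wball (wball_char c 0) => z; rewrite expr0z mulr1. Qed.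

Lemma tpoly_cat (s t : seq (R[i] * int)) z : tpoly (s ++ t) z = tpoly s z + tpoly t z.
Proof. by rewrite /tpoly big_cat. Qed.

Lemma tpoly_norm_cat (s t : seq (R[i] * int)) :
  tpoly_norm (s ++ t) = tpoly_norm s + tpoly_norm t.
Proof. by rewrite /tpoly_norm big_cat. Qed.

Lemma wballD C D phi psi : wball C phi -> wball D psi ->
  wball (C + D) (fun z => phi z + psi z).
Proof.
move=> hC hD e e0; have e2 : 0 < e / 2 by rewrite divr_gt0.
have [s [sC hs]] := hC _ e2; have [t [tD ht]] := hD _ e2.
exists (s ++ t); split; first by rewrite tpoly_norm_cat lerD.
move=> z; rewrite tpoly_cat.
have -> : phi z + psi z - (tpoly s z + tpoly t z)
  = (phi z - tpoly s z) + (psi z - tpoly t z) by ring.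
by rewrite [leRHS]splitr (le_trans (ncD _ _)) // lerD.
Qed.

(** Product of two lists of coefficients and frequencies. *)
Definition tmul (s t : seq (R[i] * int)) : seq (R[i] * int) :=
  [seq (x.1 * y.1, x.2 + y.2) | x <- s, y <- t].

Lemma tpoly_mul (s t : seq (R[i] * int)) z : tpoly (tmul s t) z = tpoly s z * tpoly t z.
Proof.
rewrite /tpoly /tmul big_allpairs_dep mulr_suml; apply: eq_bigr => x _.
rewrite mulr_sumr; apply: eq_bigr => y _ /=.
by rewrite expfzDr ?cval_neq0 // mulrACA.
Qed.

Lemma tpoly_norm_mul (s t : seq (R[i] * int)) :
  tpoly_norm (tmul s t) = tpoly_norm s * tpoly_norm t.
Proof.
rewrite /tpoly_norm /tmul big_allpairs_dep mulr_suml; apply: eq_bigr => x _.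
by rewrite mulr_sumr; apply: eq_bigr => y _; rewrite -ncM.
Qed.

Lemma wballM C D phi psi : wball C phi -> wball D psi ->
  wball (C * D) (fun z => phi z * psi z).
Proof.
move=> hC hD e e0; have C0 := wball_ge0 hC; have D0 := wball_ge0 hD.
pose d := e / (C + D + 1).
have CD0 : 0 < C + D + 1 by lra.
have d0 : 0 < d by rewrite divr_gt0.
have [s [sC hs]] := hC _ d0; have [t [tD ht]] := hD _ d0.
exists (tmul s t); split.
  by rewrite tpoly_norm_mul; apply: ler_pM => //; exact: tpoly_norm_ge0.
move=> z; rewrite tpoly_mul.
have -> : phi z * psi z - tpoly s z * tpoly t z
  = (phi z - tpoly s z) * psi z + tpoly s z * (psi z - tpoly t z) by ring.
apply: (le_trans (ncD _ _)); rewrite !ncM.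
have h1 : nc (phi z - tpoly s z) * nc (psi z) <= d * D.
  by apply: ler_pM; rewrite ?nc_ge0 //; exact: wball_le.
have h2 : nc (tpoly s z) * nc (psi z - tpoly t z) <= C * d.
  by apply: ler_pM; rewrite ?nc_ge0 //; exact: le_trans (tpoly_le s z) sC.
have E : d * (C + D + 1) = e by rewrite /d mulfVK // gt_eqF.
nra.
Qed.

Lemma wballZ (c : R[i]) C phi : wball C phi ->
  wball (nc c * C) (fun z => c * phi z).
Proof. by move=> h; apply: wballM => //; exact: wball_cst. Qed.

Lemma wballN C phi : wball C phi -> wball C (fun z => - phi z).
Proof.
move=> h; have := wballZ (-1) h; rewrite ncN nc1 mul1r.
by apply: eq_wball => z; rewrite mulN1r.
Qed.

Lemma wballX C phi n : wball C phi -> wball (C ^+ n) (fun z => phi z ^+ n).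
Proof.
move=> h; elim: n => [|n IH].
  by rewrite expr0 -[X in wball X _]nc1; exact: wball_cst.
by rewrite exprS; apply: eq_wball (wballM h IH) => z; rewrite exprS.
Qed.

Lemma wball_sum (I : Type) (r : seq I) (C : I -> R) (F : I -> circle R -> R[i]^o) :
  (forall i, wball (C i) (F i)) ->
  wball (\sum_(i <- r) C i) (fun z => \sum_(i <- r) F i z).
Proof.
move=> h; elim: r => [|i r IH].
  rewrite big_nil -[X in wball X _]nc0.
  by apply: eq_wball (wball_cst 0) => z; rewrite big_nil.
by rewrite big_cons; apply: eq_wball (wballD (h i) IH) => z; rewrite big_cons.
Qed.

Lemma conj_monomial (c : R[i]) (k : int) z :
  ((c * cval z ^ k)^*)%C = (c^*)%C * cval z ^ (- k).
Proof.
rewrite (rmorphM (@conjc R)); congr (_ * _).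
have conjX n : ((cval z ^+ n)^*)%C = (cval z)^-1 ^+ n.
  by rewrite rmorphXn /= cval_conj.
case: k => n; first by rewrite -exprz_inv; exact: conjX.
apply: (_ : (((cval z ^+ n.+1)^-1)^*)%C = cval z ^+ n.+1).
by rewrite conjc_inv conjX exprVn invrK.
Qed.

Lemma conjB (x y : R[i]) : ((x - y)^*)%C = (x^*)%C - (y^*)%C.
Proof. exact: raddfB. Qed.

Lemma wball_conj C phi : wball C phi -> wball C (fun z => ((phi z)^*)%C).
Proof.
move=> h e e0; have [s [sC hs]] := h e e0.
exists [seq ((x.1^*)%C, - x.2) | x <- s]; split.
  rewrite /tpoly_norm big_map; apply: le_trans sC; apply: ler_sum => x _.
  by rewrite nc_conj.
move=> z; have -> : tpoly [seq ((x.1^*)%C, - x.2) | x <- s] z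
   = ((tpoly s z)^*)%C.
  rewrite /tpoly big_map (raddf_sum (@conjc R)); apply: eq_bigr => x _.
  exact: esym (conj_monomial _ _ _).
by rewrite -conjB nc_conj.
Qed.

Lemma wball_pow C phi n : wball C phi -> wball C (fun z => phi (circle_pow z n)).
Proof.
move=> h e e0; have [s [sC hs]] := h e e0.
exists [seq (x.1, n%:Z * x.2) | x <- s]; split.
  by rewrite /tpoly_norm big_map.
move=> z; have -> : tpoly [seq (x.1, n%:Z * x.2) | x <- s] z
   = tpoly s (circle_pow z n).
  rewrite /tpoly big_map; apply: eq_bigr => x _ /=.
  by rewrite cval_pow exprnP exprz_exp.
exact: hs.
Qed.

Lemma wball_rot C phi w : wball C phi -> wball C (fun z => phi (circle_mul w z)).
Proof.
move=> h e e0; have [s [sC hs]] := h e e0.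
exists [seq (x.1 * cval w ^ x.2, x.2) | x <- s]; split.
  rewrite /tpoly_norm big_map; apply: le_trans sC; apply: ler_sum => x _.
  by rewrite ncM nc_cvalXz mulr1.
move=> z; have -> : tpoly [seq (x.1 * cval w ^ x.2, x.2) | x <- s] z
   = tpoly s (circle_mul w z).
  rewrite /tpoly big_map; apply: eq_bigr => x _ /=.
  by rewrite cval_mul expfzMl mulrA.
exact: hs.
Qed.

(** The balls are closed under uniform limits. *)
Lemma wball_unif C phi : (forall e, 0 < e ->
    exists psi, wball C psi /\ forall z, nc (phi z - psi z) <= e) -> wball C phi.
Proof.
move=> h e e0; have e2 : 0 < e / 2 by rewrite divr_gt0.
have [psi [hpsi hp]] := h _ e2; have [s [sC hs]] := hpsi _ e2.
exists s; split => // z.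
have := ncD (phi z - psi z) (psi z - tpoly s z); rewrite addrA subrK.
by have := hp z; have := hs z; lra.
Qed.

Lemma series_tail_le (v : nat -> R) (e : R) : (forall n, 0 <= v n) ->
  cvgn (series v) -> 0 < e ->
  exists N, forall n m, (N <= n)%N -> (n <= m)%N ->
    \sum_(n <= k < m) v k <= e.
Proof.
move=> v0 cv e0; have e2 : 0 < e / 2 by rewrite divr_gt0.
move/cvgrPdist_lt : (cv) => /(_ _ e2)[N _ hN]; exists N => n m Nn nm.
have -> : \sum_(n <= k < m) v k = series v m - series v n.
  by rewrite sub_series nm.
have /= := hN n Nn; have /= := hN m (leq_trans Nn nm).
by rewrite !ltr_norml => /andP[? ?] /andP[? ?]; lra.
Qed.

Lemma series_le_lim (v : nat -> R) n : (forall n, 0 <= v n) ->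
  cvgn (series v) -> series v n <= limn (series v).
Proof.
move=> v0 cv; apply: nondecreasing_cvgn_le => //.
by apply: nondecreasing_series => k _ _; exact: v0.
Qed.

(** Completeness of the Wiener algebra. *)
Lemma wball_series (c : nat -> R) (F : nat -> circle R -> R[i]^o) phi :
  (forall m, wball (c m) (F m)) -> cvgn (series c) ->
  (forall z, series (F ^~ z) @ \oo --> phi z) ->
  wball (limn (series c)) phi.
Proof.
move=> hF cc hphi; have c0 m : 0 <= c m by exact: wball_ge0 (hF m).
apply: wball_unif => e e0; have [N hN] := series_tail_le c0 cc e0.
exists (fun z => series (F ^~ z) N); split.
  apply: wball_mono (series_le_lim N c0 cc) _.
  have := wball_sum (index_iota 0 N) hF.
  by apply: eq_wball.
move=> z; apply: (nc_limn_le (hphi z)); exists N => // m /= Nm.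
have -> : series (F ^~ z) m - series (F ^~ z) N = \sum_(N <= k < m) F k z.
  by rewrite sub_series Nm.
apply: (le_trans (nc_sum _ _ _)); apply: le_trans (hN N m (leqnn N) Nm).
by apply: ler_sum => k _; exact: wball_le.
Qed.

End wiener_algebra.

(** * Spectral radius and Neumann series *)

Section spectral_radius.
Context (R : realType).
Implicit Types (phi psi u : circle R -> R[i]^o) (C D e : R).
Local Notation nc := (@Normc.normc R).

Lemma wiener_ex_wball u : wiener u -> exists C, wball C u.
Proof.
move=> wu; exists (fine (norm1 u)); apply: wiener_wball => //.
case: wu => _ n1; rewrite fineK // ge0_fin_numE //.
by apply: esum_ge0 => k _; rewrite lee_fin nc_ge0.
Qed.

(** Trigonometric polynomials are dense for the norm of the Wiener algebra. *)
Lemma wiener_tpoly_approx u e : wiener u -> 0 < e ->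
  exists s, wball e (fun z => u z - tpoly s z).
Proof.
move=> wu e0; case: (wu) => cu n1.
have f0 k : (0 <= (nc (fourier u k))%:E)%E by rewrite lee_fin nc_ge0.
have nfin : norm1 u \is a fin_num.
  by rewrite ge0_fin_numE //; apply: esum_ge0.
have [_ [A [fA _] <-] hA] := ub_ereal_sup_adherent e0 nfin.
pose r := finmap.enum_fset (fset_set A).
have ur : uniq r by exact: finmap.fset_uniq.
have rA k : (k \in r) = (k \in A) by rewrite -in_fset_set.
pose s := [seq (fourier u k, k) | k <- r]; exists s.
have cps : continuous (fun z => u z - tpoly s z : R[i]^o).
  exact/continuous_sub/continuous_tpoly.
have E k : fourier (fun z => u z - tpoly s z) k =
    if k \in A then 0 else fourier u k.
  rewrite fourierE (_ : (fun z => _) = (fun z => u z * cval z ^ (- k)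
     - tpoly s z * cval z ^ (- k))); last by apply/funext => z; rewrite mulrBl.
  rewrite cmeanB; [|exact: continuous_char|exact/continuous_char/continuous_tpoly].
  rewrite -!fourierE fourier_tpoly /s big_map -rA -big_filter /=.
  rewrite (@eq_filter _ _ (pred1 k)) //.
  case: ifP => kr; first by rewrite filter_pred1_uniq // big_seq1 subrr.
  have -> : [seq j <- r | pred1 k j] = [::].
    by apply/eqP; rewrite -(negbK (_ == _)) -has_filter has_pred1 kr.
  by rewrite big_nil subr0.
set psi := (fun z => u z - tpoly s z) in cps E *.
have hn : (norm1 psi <= e%:E)%E.
  rewrite /norm1 (esumID A) //; last by move=> k _; rewrite lee_fin nc_ge0.
  rewrite esum1 ?add0e; last first.
    by move=> k [_ Ak]; rewrite E mem_set // nc0.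
  rewrite (eq_esum (b := fun k => (nc (fourier u k))%:E)); last first.
    by move=> k [_ Ak]; rewrite E memNset.
  have EU : norm1 u = (\esum_(k in A) (nc (fourier u k))%:E +
      \esum_(k in ~` A) (nc (fourier u k))%:E)%E.
    by rewrite /norm1 (esumID A) // !setTI.
  move: hA nfin; rewrite -[ereal_sup _]/(norm1 u) EU -esum_fset // setTI.
  set a := esum A _; set b := esum _ _.
  have a0 : (0 <= a)%E by exact: esum_ge0.
  have b0 : (0 <= b)%E by exact: esum_ge0.
  move: a0 b0; case: a => [a| |] //; case: b => [b| |] //.
  by rewrite -EFinD -EFinB lte_fin !lee_fin => ? ? ? _; lra.
have wp : wiener psi by split; [exact: cps|exact: le_lt_trans hn (ltry _)].
exact: wiener_wball wp hn.
Qed.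

(** A trigonometric polynomial of degree at most N has at most 2N + 1
    coefficients, each bounded by its sup norm. *)
Lemma wball_degree (s : seq (R[i] * int)) (N : nat) (B : R) :
  (forall x, x \in s -> (absz x.2 <= N)%N) ->
  (forall z, nc (tpoly s z) <= B) -> wball ((N + N).+1%:R * B) (tpoly s).
Proof.
move=> hs hB; have cs := @continuous_tpoly R s.
pose t := [seq (fourier (tpoly s) (j%:Z - N%:Z), j%:Z - N%:Z)
  | j <- iota 0 (N + N).+1].
have st : tpoly t =1 tpoly s.
  move=> z; rewrite /tpoly big_map sum_iota_ord /=.
  under eq_bigr do rewrite fourier_tpoly mulr_suml.
  rewrite (exchange_big_dep xpredT) //= [LHS]big_seq [RHS]big_seq.
  apply: eq_bigr => x /hs xN.
  have jN : (absz (x.2 + N%:Z)%R < (N + N).+1)%N by lia.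
  have jE : (absz (x.2 + N%:Z)%R)%:Z = x.2 + N%:Z by lia.
  rewrite (bigD1 (Ordinal jN)) /=; last by rewrite jE addrK.
  rewrite jE addrK big1 ?addr0 // => j /andP[/eqP xj]; rewrite -val_eqE /=.
  by rewrite xj subrK eqxx.
apply: (eq_wball st); apply: wball_mono (wball_tpoly t).
rewrite /tpoly_norm big_map sum_iota_ord mulr_natl -[X in _ *+ X]card_ord.
rewrite -sumr_const; apply: ler_sum => j _.
rewrite -[leLHS]/(nc (fourier (tpoly s) (j%:Z - N%:Z))) fourierE -(rmean_cst B); apply: nc_cmean_le.
- exact: continuous_char.
- exact: rcont_cst.
- by move=> z; rewrite ncM nc_cvalXz mulr1.
Qed.

(** Powers of a trigonometric polynomial, as lists of coefficients. *)
Fixpoint tpow (s : seq (R[i] * int)) n : seq (R[i] * int) :=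
  if n is n'.+1 then tmul s (tpow s n') else [:: (1, 0)].

Lemma tpoly_pow s n z : tpoly (tpow s n) z = tpoly s z ^+ n.
Proof.
elim: n => [|n IH]; first by rewrite /tpoly big_seq1 expr0z mulr1.
by rewrite /= tpoly_mul IH exprS.
Qed.

Lemma tpow_degree s d n : (forall x, x \in s -> (absz x.2 <= d)%N) ->
  forall x, x \in tpow s n -> (absz x.2 <= n * d)%N.
Proof.
move=> hs; elim: n => [|n IH] x /=; first by rewrite inE => /eqP -> /=.
move=> /allpairsP[[y1 y2] /= [/hs h1 /IH h2 ->]] /=.
rewrite mulSn; apply: leq_trans (leq_add h1 h2).
by move: (y1.2) (y2.2) => a c; lia.
Qed.

Lemma bounded_degree (s : seq (R[i] * int)) :
  exists d, forall x, x \in s -> (absz x.2 <= d)%N.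
Proof.
elim: s => [|y s [d hd]]; first by exists 0%N.
exists (maxn (absz y.2) d) => x; rewrite inE leq_max => /orP[/eqP ->|/hd ->].
  by rewrite leqnn.
by rewrite orbT.
Qed.

(** The spectral radius of an element of the Wiener algebra is at most its sup
    norm: split off a trigonometric polynomial up to a small error and expand
    the powers binomially. *)
Lemma wball_powers u B : wiener u -> 0 <= B < 1 -> (forall z, nc (u z) <= B) ->
  exists D r : R, [/\ 0 <= D, 0 <= r < 1 &
    forall n, wball (D * r ^+ n) (fun z => u z ^+ n)].
Proof.
(* [e] is chosen so that [B + 2 e < 1] *)
move=> wu /andP[B0 B1] uB; pose e : R := (1 - B) / 4.
have e0 : 0 < e by rewrite /e; lra.
have [s hr] := wiener_tpoly_approx wu e0.
have [d hd] := bounded_degree s.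
pose b := B + e; have b0 : 0 <= b by rewrite /b; lra.
have hb z : nc (tpoly s z) <= b.
  have := wball_le z hr; have := uB z.
  by have := ncD (u z) (- (u z - tpoly s z)); rewrite opprB addrC subrK ncB /b; lra.
have hP n : wball ((n * d + n * d).+1%:R * b ^+ n) (fun z => tpoly s z ^+ n).
  have := @wball_degree (tpow s n) (n * d) (b ^+ n) (tpow_degree hd) _.
  move=> h; apply: (eq_wball (tpoly_pow s n)); apply: h => z.
  by rewrite tpoly_pow ncX; apply: lerXn2r; rewrite ?nnegrE ?nc_ge0.
have q01 : 0 <= b + e < 1 by rewrite /b /e; apply/andP; split; lra.
have [C [r [C0 r01 hC]]] := linear_geometric_le q01.
exists ((d + d).+1%:R * C), r; split => //; first exact: mulr_ge0.
move=> n.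
have hn := wball_sum (index_enum 'I_n.+1) (fun i : 'I_n.+1 =>
  wballZ (('C(n, i)%:R : R)%:C)%C (wballM (hP (n - i)%N) (wballX i hr))).
apply: wball_mono (eq_wball _ hn); last first.
  move=> z /=; rewrite -[u z](subrK (tpoly s z)) [u z - _ + _]addrC exprDn.
  by apply: eq_bigr => i _; rewrite real_complex_nat mulr_natl addrC subrK.
apply: (@le_trans _ _ (\sum_(i < n.+1) (n * d + n * d).+1%:R *
    (b ^+ (n - i) * e ^+ i *+ 'C(n, i)))).
  apply: ler_sum => i _; rewrite nc_real ger0_norm //.
  rewrite [leLHS](_ : _ = ((n - i) * d + (n - i) * d).+1%:R *
    (b ^+ (n - i) * e ^+ i *+ 'C(n, i))); last by rewrite -[_ *+ 'C(n, i)]mulr_natl; ring.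
  apply: ler_wpM2r; first by rewrite mulrn_wge0 // mulr_ge0 ?exprn_ge0 ?(ltW e0).
  by rewrite ler_nat ltnS leq_add // leq_mul // leq_subr.
rewrite -mulr_sumr -exprDn.
apply: (@le_trans _ _ ((d + d).+1%:R * (n.+1%:R * (b + e) ^+ n))).
  rewrite mulrA; apply: ler_wpM2r; first by rewrite exprn_ge0 //; case/andP: q01.
  by rewrite -natrM ler_nat -mulnDr mulSn addSn ltnS mulnS mulnC; nia.
rewrite -[leRHS]mulrA. by apply: ler_wpM2l.
Qed.

(** Inversion of [1 - u] by its Neumann series. *)
Lemma wball_neumann u B : wiener u -> 0 <= B < 1 -> (forall z, nc (u z) <= B) ->
  exists D, wball D (fun z => (1 - u z)^-1).
Proof.
move=> wu B01 uB; have [D [r [D0 r01 h]]] := wball_powers wu B01 uB.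
have /andP[B0 B1] := B01; have /andP[r0 r1] := r01.
have cg : cvgn (series (fun n => D * r ^+ n)).
  by apply: is_cvg_geometric_series; rewrite ger0_norm.
exists (limn (series (fun n => D * r ^+ n))).
apply: (wball_series h cg) => z; apply/cvgCP => e e0.
have n1 : 1 - B <= nc (1 - u z).
  have := ncD (1 - u z) (u z); rewrite subrK nc1; have := uB z; lra.
have u1 : 1 - u z != 0.
  by apply/eqP => E; move: n1; rewrite E nc0; lra.
have B10 : 0 < 1 - B by lra.
have [N hN] := geometric_small 1 B01 (mulr_gt0 e0 B10).
exists N => //= n Nn.
have -> : series (fun n => u z ^+ n) n - (1 - u z)^-1 = - (u z ^+ n / (1 - u z)).
  apply: (mulIf u1); rewrite mulrBl mulVf // mulNr mulfVK //.
  rewrite /series /= big_mkord; have := subrX1 (u z) n.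
  by move=> /eqP; rewrite subr_eq => /eqP ->; ring.
rewrite ncN ncM ncV ltr_pdivrMr; last by apply: lt_le_trans n1; lra.
apply: (@le_lt_trans _ _ (B ^+ n)).
  by rewrite ncX; apply: lerXn2r; rewrite ?nnegrE ?nc_ge0.
apply: (@lt_le_trans _ _ (e * (1 - B))); first by have := hN n Nn; rewrite mul1r.
by rewrite ler_pM2l.
Qed.

End spectral_radius.

(** * Bump functions in the Wiener algebra *)

Section bumps.
Context (R : realType).
Implicit Types (z w : circle R) (g h : circle R -> R).
Local Notation nc := (@Normc.normc R).

(** A real function on the circle, seen as a complex function. *)
Definition rfun g : circle R -> R[i]^o := fun z => ((g z)%:C)%C.

Local Notation re z := (complex.Re (cval z)).

Lemma re_cval z : ((re z)%:C)%C = 2^-1 * cval z ^ 1 + 2^-1 * cval z ^ (-1).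
Proof.
rewrite expr1z exprN1 -cval_conj -mulrDr.
by rewrite ReJ_add mulrC.
Qed.

Lemma real_complexB (r s : R) : ((r - s)%:C)%C = (r%:C)%C - (s%:C)%C :> R[i].
Proof. exact: raddfB. Qed.

Lemma real_complex_V2 : ((2^-1 : R)%:C)%C = 2^-1 :> R[i].
Proof. by rewrite -(real_complex_nat R 2); exact: fmorphV. Qed.

Lemma nc_nat k : nc k%:R = k%:R.
Proof. by rewrite -real_complex_nat nc_real ger0_norm. Qed.

Lemma nc_natV k : nc k%:R^-1 = k%:R^-1.
Proof. by rewrite ncV nc_nat. Qed.

Lemma wball_re : wball 1 (rfun (fun z => re z)).
Proof.
have := wballD (wball_char 2^-1 1) (wball_char 2^-1 (-1) : wball _ (fun z : circle R => _)).
have E : (2^-1 : R) + 2^-1 = 1 by field.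
by rewrite nc_natV E; apply: eq_wball => z; rewrite /rfun re_cval.
Qed.

Lemma wball_re2 : wball 1 (rfun (fun z => 1 - re z ^+ 2)).
Proof.
have h := wballD (wball_cst (2^-1 : R[i])) (wballD (wball_char (- 4^-1) 2)
  (wball_char (- 4^-1) (-2) : wball _ (fun z : circle R => _))).
have E : nc (2^-1) + (nc (- 4^-1) + nc (- 4^-1)) = 1.
  by rewrite !ncN !nc_natV; field.
rewrite E in h; apply: eq_wball h => z; rewrite /rfun.
rewrite real_complexB (_ : ((re z ^+ 2)%:C)%C = ((re z)%:C)%C ^+ 2); last exact: real_complexX.
rewrite re_cval.
rewrite expr1z exprN1 -[cval z ^ 2]exprnP -[cval z ^ (-2)]exprnN.
have := cval_neq0 z; move: (cval z) => x x0.
by field.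
Qed.

(** The iteration [q_{k+1} = (1 - x^2 + q_k^2) / 2], starting from 0, tends to
    [1 - |x|] uniformly for [|x| <= 1]; its terms are polynomials in [1 - x^2]
    with non-negative coefficients of sum at most 1. *)
Fixpoint absq (x : R) k : R :=
  if k is k'.+1 then (1 - x ^+ 2 + absq x k' ^+ 2) / 2 else 0.

Lemma wball_absq k : wball 1 (rfun (fun z => absq (re z) k)).
Proof.
elim: k => [|k IH].
  by apply: wball_mono (wball_cst 0); rewrite nc0.
have h := wballZ 2^-1 (wballD wball_re2 (wballM IH IH)).
have E : nc (2^-1) * (1 + 1 * 1) = 1 by rewrite nc_natV; field.
rewrite E in h; apply: eq_wball h => z.
rewrite /rfun [absq _ k.+1]/=; set q := absq _ k.
rewrite [RHS]real_complexM real_complex_V2 [in RHS]real_complexD.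
rewrite (_ : ((q ^+ 2)%:C)%C = (q%:C)%C * (q%:C)%C); last exact: real_complexM.
exact: mulrC.
Qed.

Lemma absq_bound (x : R) k : `|x| <= 1 ->
  `|x| <= 1 - absq x k <= 1 /\ 1 - absq x k <= `|x| + 2 / k.+2%:R.
Proof.
move=> x1; have x0 := normr_ge0 x.
have xx : x ^+ 2 = `|x| ^+ 2 by rewrite real_normK ?num_real.
elim: k => [|k [/andP[h1 h2] h3]] /=.
  by rewrite subr0 x1 lexx divff //; split => //; lra.
rewrite xx; set p := 1 - absq x k in h1 h2 h3.
have -> : absq x k = 1 - p by rewrite /p; ring.
set a := `|x| in h1 h2 h3 x0 x1 *.
set t := 2 / k.+2%:R in h3; set t' := 2 / k.+3%:R.
have k0 : 0 <= k%:R :> R by [].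
have t01 : 0 < t <= 1.
  rewrite /t divr_gt0 //= ler_pdivrMr // mul1r ler_nat //.
have tt' : t - t ^+ 2 / 2 <= t'.
  rewrite /t /t' -[k.+3%:R]natr1 -[k.+2%:R]natr1 -[k.+1%:R]natr1.
  rewrite -subr_ge0.
  have -> : 2 / (k%:R + 1 + 1 + 1) - (2 / (k%:R + 1 + 1) - (2 / (k%:R + 1 + 1)) ^+ 2 / 2)
     = 2 / ((k%:R + 1 + 1 + 1) * (k%:R + 1 + 1) ^+ 2) :> R.
    by field; rewrite !gt_eqF //; lra.
  by rewrite divr_ge0 // mulr_ge0 ?exprn_ge0 //; lra.
have -> : 1 - (1 - a ^+ 2 + (1 - p) ^+ 2) / 2 = p - (p ^+ 2 - a ^+ 2) / 2 by field.
have d0 : 0 <= p - a by lra.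
move: t01 => /andP[t0 t1].
split; first by apply/andP; split; nra.
apply: (@le_trans _ _ (a + (t - t ^+ 2 / 2))); last by rewrite lerD2l.
pose d := p - a; have dE : p = a + d by rewrite /d; ring.
rewrite dE in h1 h2 h3 d0 *.
have dt : 0 <= (t - d) * (2 - t - d) by rewrite mulr_ge0 //; lra.
have ad : 0 <= a * d by rewrite mulr_ge0 //; lra.
by nra.
Qed.

Lemma re_le1 z : `|re z| <= 1.
Proof. by rewrite -(nc_cval z) Re_le_nc. Qed.

Lemma rfunB_nc g h z : nc (rfun g z - rfun h z) = `|g z - h z|.
Proof. by rewrite /rfun -real_complexB nc_real. Qed.

(** [|cos t|] has an absolutely convergent Fourier series. *)
Lemma wball_abs_re : wball 2 (rfun (fun z => `|re z|)).
Proof.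
apply: wball_unif => e e0.
have [N /= hN] : exists N : nat, 2 / N.+2%:R <= e.
  have [N] := ltr_add_invr (divr_gt0 e0 (ltr0n R 2)).
  rewrite add0r => hN.
  exists N.+1; rewrite ler_pdivrMr //.
  have h1 : 1 <= e / 2 * N.+1%:R.
    by have := ler_wpM2r (ler0n R N.+1) (ltW hN); rewrite mulVf.
  have h2 : e * N.+1%:R <= e * N.+3%:R by rewrite ler_pM2l // ler_nat; lia.
  by lra.
exists (rfun (fun z => 1 - absq (re z) N)); split.
  have := wballD (wball_cst 1) (wballN (wball_absq N)).
  by rewrite nc1; apply: eq_wball => z; rewrite /rfun real_complexB.
move=> z; rewrite rfunB_nc.
have [/andP[h1 h2] h3] := absq_bound N (re_le1 z).
have h4 : 1 - absq (re z) N <= `|re z| + e.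
  by apply: (le_trans h3); rewrite lerD2l.
move: h1 h2 h4; clear; move: (`|re z|) (absq (re z) N) => a q h1 h2 h4.
rewrite ler0_norm; first by lra.
by lra.
Qed.

Local Notation cosp z := ((re z + `|re z|) / 2).

Lemma wball_cosp : exists C, wball C (rfun (fun z => cosp z)).
Proof.
eexists; apply: eq_wball (wballZ (2^-1) (wballD wball_re wball_abs_re)) => z.
rewrite /rfun real_complexM real_complexD real_complex_V2.
exact: mulrC.
Qed.

Lemma wball_rfunM g h C D : wball C (rfun g) -> wball D (rfun h) ->
  wball (C * D) (rfun (fun z => g z * h z)).
Proof.
by move=> hg hh; apply: eq_wball (wballM hg hh) => z; rewrite /rfun real_complexM.
Qed.

Lemma wball_rfunD g h C D : wball C (rfun g) -> wball D (rfun h) ->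
  wball (C + D) (rfun (fun z => g z + h z)).
Proof.
by move=> hg hh; apply: eq_wball (wballD hg hh) => z; rewrite /rfun real_complexD.
Qed.

(** With [x = cos t], [y = sin t], [p = cos a] and [s = sin a], the two factors
    are the positive parts of [cos (t + a)] and [cos (t - a)]. *)
Lemma maxp_mul_le (p s x y : R) : 0 < p -> x ^+ 2 <= 1 ->
  0 <= (p * x - s * y + `|p * x - s * y|) / 2
     * ((p * x + s * y + `|p * x + s * y|) / 2) <= p ^+ 2.
Proof.
move=> p0 x1.
have h (t : R) : (t + `|t|) / 2 = Num.max t 0.
  by case: (leP t 0) => t0; [rewrite ler0_norm // subrr mul0r|rewrite gtr0_norm //; field].
rewrite !h; apply/andP; split; first by rewrite mulr_ge0 // le_max lexx orbT.
have p2 : 0 <= p ^+ 2 by exact: sqr_ge0.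
case: (leP _ 0) => h1; first by rewrite mul0r.
case: (leP _ 0) => h2; first by rewrite mulr0.
have : 0 <= (s * y) ^+ 2 by exact: sqr_ge0.
have : 0 <= p ^+ 2 * (1 - x ^+ 2) by rewrite mulr_ge0 // subr_ge0.
nra.
Qed.

(** The product above vanishes at distance at least [r] from 1 (the squared
    distance is [2 - 2 x]) as soon as [cos a] is small with respect to [r]. *)
Lemma maxp_mul_eq0 (p s x y r : R) : 0 < p -> p <= 2^-1 -> p <= r / 2 ->
  p ^+ 2 + s ^+ 2 = 1 -> x ^+ 2 + y ^+ 2 = 1 -> r ^+ 2 <= 2 - 2 * x ->
  (p * x - s * y + `|p * x - s * y|) / 2
     * ((p * x + s * y + `|p * x + s * y|) / 2) = 0.
Proof.
move=> p0 p2 pr ps xy rx.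
have h (t : R) : (t + `|t|) / 2 = Num.max t 0.
  by case: (leP t 0) => t0; [rewrite ler0_norm // subrr mul0r|rewrite gtr0_norm //; field].
rewrite !h; case: (leP _ 0) => h1; first by rewrite mul0r.
case: (leP _ 0) => h2; first by rewrite mulr0.
exfalso.
have x0 : 0 < x by rewrite -(pmulr_rgt0 _ p0); lra.
have p22 : p ^+ 2 <= 4^-1 by nra.
have pr2 : 4 * p ^+ 2 <= r ^+ 2 by nra.
have h3 : (s * y) ^+ 2 < (p * x) ^+ 2 by have := mulr_gt0 h1 h2; nra.
have y2 : 0 <= y ^+ 2 by exact: sqr_ge0.
have x1 : x <= 1 by nra.
have x21 : x ^+ 2 <= 1 by lra.
have h4 : 3 / 4 * y ^+ 2 <= p ^+ 2.
  rewrite exprMn in h3; rewrite [X in _ < X]exprMn in h3.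
  have : p ^+ 2 * x ^+ 2 <= p ^+ 2 by rewrite ler_piMr // sqr_ge0.
  have : 0 <= (s ^+ 2 - 3 / 4) * y ^+ 2 by rewrite mulr_ge0 //; lra.
  by lra.
have h5 : 1 - x <= y ^+ 2 by nra.
have : 0 < p ^+ 2 by rewrite exprn_gt0.
lra.
Qed.

(** Bump functions in the Wiener algebra: up to a rotation, products
    [cos_+ (t - a) cos_+ (t + a)] with [a] close to a right angle. *)
Lemma wiener_bump w (r : R) : 0 < r -> exists g, [/\ exists C, wball C (rfun g),
  g w = 1, forall z, 0 <= g z <= 1 & forall z, r <= nc (cval z - cval w) -> g z = 0].
Proof.
move=> r0; pose p : R := Num.min (2^-1) (r / 2).
have p0 : 0 < p by rewrite /p lt_min invr_gt0 ltr0n divr_gt0.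
have p2 : p <= 2^-1 by rewrite /p ge_min lexx.
have pr : p <= r / 2 by rewrite /p ge_min lexx orbT.
pose s : R := Num.sqrt (1 - p ^+ 2).
have ps : p ^+ 2 + s ^+ 2 = 1 by rewrite /s sqr_sqrtr; [ring|nra].
have au : ((p +i* s)%C : R[i]^o) \in @unit_circle R.
  by apply/mem_set; rewrite /unit_circle /= normc_def /= ps sqrtr1.
pose a : circle R := SigSub au.
have aE : cval a = (p +i* s)%C by [].
pose b : circle R := circle_inv a.
have bE : cval b = (p -i* s)%C by rewrite cval_inv -cval_conj aE.
pose g0 z : R := cosp (circle_mul a z) * cosp (circle_mul b z) / p ^+ 2.
have g0E z : g0 z = (p * re z - s * complex.Im (cval z) + `|p * re z - s * complex.Im (cval z)|) / 2
     * ((p * re z + s * complex.Im (cval z) + `|p * re z + s * complex.Im (cval z)|) / 2) / p ^+ 2.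
  rewrite /g0 !cval_mul aE bE; case: (cval z) => x y.
  by rewrite /= mulNr opprK.
have zxy z : re z ^+ 2 + complex.Im (cval z) ^+ 2 = 1.
  have := nc_cval z; case: (cval z) => x y /= h.
  by rewrite -[LHS]sqr_sqrtr ?addr_ge0 ?sqr_ge0 // h expr1n.
exists (fun z => g0 (circle_mul (circle_inv w) z)); split.
- have [C hC] := wball_cosp.
  have hp := wball_cst (((p ^+ 2)^-1)%:C)%C.
  have h := wballM (wball_rfunM (wball_rot a hC) (wball_rot b hC)) hp.
  eexists; apply: eq_wball (wball_rot (circle_inv w) h) => z.
  by rewrite /rfun -real_complexM.
- rewrite g0E cval_mul cval_inv mulVf ?cval_neq0 //= mulr1 mulr0 addr0 subr0.
  by rewrite gtr0_norm //; field; rewrite gt_eqF.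
- move=> z; rewrite g0E; have := zxy (circle_mul (circle_inv w) z).
  set x := re _; set y := complex.Im _ => xy.
  have x1 : x ^+ 2 <= 1 by have := sqr_ge0 y; lra.
  have /andP[h1 h2] := maxp_mul_le s y p0 x1.
  have pp : 0 < p ^+ 2 by rewrite exprn_gt0.
  by rewrite divr_ge0 // ?(ltW pp) //= ler_pdivrMr // mul1r.
- move=> z rz; rewrite g0E; have := zxy (circle_mul (circle_inv w) z).
  set u := circle_mul _ z.
  have uE : cval z - cval w = cval w * (cval u - 1).
    by rewrite /u cval_mul cval_inv mulrBr mulr1 mulrA divff ?mul1r ?cval_neq0.
  move: rz; rewrite uE ncM nc_cval mul1r; case: (cval u) => x y /= rz xy.
  rewrite (maxp_mul_eq0 p0 p2 pr ps xy) ?mul0r //.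
  move: rz; rewrite subr0 => rz.
  have : r ^+ 2 <= (x - 1) ^+ 2 + y ^+ 2.
    rewrite -[leRHS]sqr_sqrtr ?addr_ge0 ?sqr_ge0 // ler_pXn2r ?nnegrE ?sqrtr_ge0 //.
    exact: ltW.
  have -> : (x - 1) ^+ 2 = x ^+ 2 - 2 * x + 1 by ring.
  by lra.
Qed.

End bumps.

(** * Inverting positive functions on a compact set *)

Section inversion_on_compact.
Context (R : realType).
Implicit Types (z w : circle R) (g h : circle R -> R) (K : set (circle R)).
Local Notation nc := (@Normc.normc R).

Lemma real_complex_sum (I : Type) (r : seq I) (F : I -> R) :
  ((\sum_(i <- r) F i)%:C)%C = \sum_(i <- r) ((F i)%:C)%C :> R[i].
Proof. exact: raddf_sum. Qed.

Lemma rfun_continuousP g : continuous (rfun g) <->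
  forall z (e : R), 0 < e -> exists2 d : R, 0 < d &
    forall w, nc (cval w - cval z) < d -> `|g w - g z| < e.
Proof.
rewrite continuous_circleP; split => h z e e0; have [d d0 hd] := h z e e0;
  by exists d => // w /hd; rewrite rfunB_nc.
Qed.

Lemma open_pos g : continuous (rfun g) -> open [set z | 0 < g z].
Proof.
move=> /rfun_continuousP cg; rewrite openE => z /= gz.
have [d d0 hd] := cg z _ gz.
apply/nbhs_circleP; exists d => // w /hd.
by rewrite ltr_distl => /andP[]; rewrite subrr.
Qed.

Lemma compact_finite_cover (T : topologicalType) (A : set T) (V : T -> set T) :
  compact A -> (forall x, A x -> nbhs x (V x)) ->
  exists s : seq T, forall x, A x -> exists2 y, y \in s & V y x.
Proof.
move=> /compact_near_coveringP cA hV.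
pose F := filter_from [set: seq T] (fun t => [set s : seq T | {subset t <= s}]).
have FF : Filter F.
  apply: filter_from_filter; first by exists [::].
  move=> t1 t2 _ _; exists (t1 ++ t2) => // s /= h.
  by split => x xt; apply: h; rewrite mem_cat xt ?orbT.
have [|t _ ht] := cA _ F (fun s x => exists2 y, y \in s & V y x) FF.
  move=> x Ax; exists (V x, [set s : seq T | {subset [:: x] <= s}]).
    by split; [exact: hV|exists [:: x]].
  by move=> [y s] /= [Vy sx]; exists x => //; apply: sx; rewrite inE.
by exists t; exact: ht.
Qed.

Lemma compact_pos_lower K g : compact K -> continuous (rfun g) ->
  (forall z, K z -> 0 < g z) -> exists2 d : R, 0 < d & forall z, K z -> d <= g z.
Proof.
move=> cK /rfun_continuousP cg gK.
have [z Kz|C C0 hC] := @compact_bounded_above R _ K (fun z => (g z)^-1) cK.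
  have g2 : 0 < g z / 2 by rewrite divr_gt0 // gK.
  have [d d0 hd] := cg z _ g2; exists (g z / 2)^-1.
  apply/nbhs_circleP; exists d => // w /hd; rewrite ltr_distl => /andP[h _].
  by rewrite lef_pV2 ?posrE //; lra.
exists (C + 1)^-1; first by rewrite invr_gt0; lra.
move=> z Kz; rewrite -[leRHS]invrK lef_pV2 ?posrE ?invr_gt0 ?gK //; last by lra.
by have := hC z Kz; lra.
Qed.

(** A multiple of [g] is of the form [1 - u] with [u] bounded by a constant
    smaller than 1. *)
Lemma wball_inv_pos g C : wball C (rfun g) -> (forall z, 0 < g z) ->
  exists D, wball D (rfun (fun z => (g z)^-1)).
Proof.
move=> hg g0; have cg := wball_continuous hg.
have [d d0 hd] := compact_pos_lower (@circle_compact R) cg (fun z _ => g0 z).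
pose M := C + d; have M0 : 0 < M by have := wball_ge0 hg; rewrite /M; lra.
have gM z : g z <= M.
  have := wball_le z hg; rewrite /rfun nc_real => /ler_normlP[_ h].
  by rewrite /M; lra.
have hu := wballD (wball_cst 1) (wballN (wballM (wball_cst ((M^-1)%:C)%C) hg)).
have [wu _] := wball_wiener hu.
have B01 : 0 <= 1 - d / M < 1.
  have : 0 < d / M by rewrite divr_gt0.
  have : d / M <= 1 by rewrite ler_pdivrMr // mul1r (le_trans (hd (expi 0) I)).
  by move=> ? ?; apply/andP; split; lra.
have [|D hD] := wball_neumann wu B01.
  move=> z; rewrite /rfun -real_complexM -(real_complexB 1) nc_real.
  have h1 : d / M <= M^-1 * g z by rewrite mulrC ler_pM2l ?invr_gt0 // hd.
  have h2 : M^-1 * g z <= 1 by rewrite mulrC ler_pdivrMr // mul1r.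
  by rewrite ger0_norm; lra.
eexists; apply: eq_wball (wballM (wball_cst ((M^-1)%:C)%C) hD) => z.
have gz : (g z)%:C%C != 0 :> R[i] by rewrite (inj_eq (@complexI R)) gt_eqF.
have Mz : M%:C%C != 0 :> R[i] by rewrite (inj_eq (@complexI R)) gt_eqF.
have E (r : R) : ((r^-1)%:C)%C = (r%:C)%C^-1 :> R[i] by exact: fmorphV.
rewrite /rfun !E; apply: (mulIf gz); rewrite mulVf //.
move: gz Mz; move: ((g z)%:C)%C ((M%:C)%C) => x y x0 y0.
by field; rewrite subKr x0 y0.
Qed.

(** Adding to [g] finitely many bumps that vanish on [K] makes it positive on the
    whole circle. *)
Lemma wiener_inv_on K g C : compact K -> wball C (rfun g) -> (forall z, 0 <= g z) ->
  (forall z, K z -> 0 < g z) ->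
  exists u, (exists D, wball D u) /\ forall z, K z -> u z * rfun g z = 1.
Proof.
move=> cK hg g0 gK; have cg := wball_continuous hg.
have clK : closed K by exact: compact_circle_closed.
have bumps w : exists h, [/\ exists D, wball D (rfun h), forall z, 0 <= h z,
    forall z, K z -> h z = 0 & 0 < g w + h w].
  have [Kw|nKw] := pselect (K w).
    exists (fun=> 0); split => // ; last by rewrite addr0 gK.
    by exists (nc 0); exact: wball_cst.
  have : nbhs w (~` K) by apply: open_nbhs_nbhs; split => //; exact: closed_openC.
  move=> /nbhs_circleP[r r0 hr].
  have [h [hD hw h01 hz]] := wiener_bump w r0.
  exists h; split => // [z|z Kz|]; first by case/andP: (h01 z).
    by apply: hz; rewrite leNgt; apply/negP => /hr.
  by rewrite hw; have := g0 w; lra.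
have [h hP] := choice bumps.
have gh0 z : 0 < g z + h z z by have [_ _ _] := hP z.
have hU w : open [set z | 0 < g z + h w z].
  apply: open_pos; have [[D hD] _ _ _] := hP w.
  exact: wball_continuous (wball_rfunD hg hD).
have [S0 cov0] := @compact_finite_cover _ setT (fun w => [set z | 0 < g z + h w z])
  (@circle_compact R) (fun z _ => open_nbhs_nbhs (conj (hU z) (gh0 z))).
pose S := undup S0.
have cov z : exists2 w, w \in S & 0 < g z + h w z.
  by have [w wS ?] := cov0 z I; exists w; rewrite ?mem_undup.
pose G z := g z + \sum_(w <- S) h w z.
have [D hD] : exists D, wball D (rfun (fun z => \sum_(w <- S) h w z)).
  have hc w : exists D, wball D (rfun (h w)) by have [] := hP w.
  have [D hD] := choice hc.
  eexists; apply: eq_wball (wball_sum (S) hD) => z.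
  exact/esym/real_complex_sum.
have G0 z : 0 < G z.
  have [w wS gh] := cov z; apply: (lt_le_trans gh); rewrite lerD2l.
  rewrite (bigD1_seq w) //= ?undup_uniq // lerDl; apply: sumr_ge0 => v _.
  by have [_ + _ _] := hP v.
have [D' hD'] := wball_inv_pos (wball_rfunD hg hD) G0.
exists (rfun (fun z => (G z)^-1)); split; first by exists D'.
move=> z Kz; rewrite /rfun -real_complexM.
have -> : G z = g z.
  by rewrite /G big1 ?addr0 // => w _; have [_ _ hz _] := hP w; exact: hz.
by rewrite mulVf // gt_eqF // gK.
Qed.

(** For continuous functions it suffices to invert [max(g, d)], where [d] is a
    lower bound of [g] on [K]. *)
Lemma continuous_inv_on K g : compact K -> continuous (rfun g) ->
  (forall z, K z -> 0 < g z) ->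
  exists u : circle R -> R[i]^o, continuous u /\ forall z, K z -> u z * rfun g z = 1.
Proof.
move=> cK cg gK; have [d d0 hd] := compact_pos_lower cK cg gK.
exists (rfun (fun z => (Num.max (g z) d)^-1)); split.
  apply/rfun_continuousP => z e e0.
  have ed : 0 < e * d ^+ 2 by rewrite mulr_gt0 // exprn_gt0.
  have [t t0 ht] := (rfun_continuousP g).1 cg z _ ed; exists t => // w /ht hw.
  set a := Num.max (g w) d; set b := Num.max (g z) d.
  have da : d <= a by rewrite /a le_max lexx orbT.
  have db : d <= b by rewrite /b le_max lexx orbT.
  have a0 : 0 < a by lra.
  have b0 : 0 < b by lra.
  have ab : `|a - b| <= `|g w - g z|.
    have h1 := ler_norm (g w - g z).
    have := ler_norm (- (g w - g z)); rewrite normrN => h2.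
    rewrite /a /b; case: (leP (g w) d) => ?; case: (leP (g z) d) => ?;
      by rewrite ler_norml; apply/andP; split; lra.
  have -> : a^-1 - b^-1 = (b - a) / (a * b) by field; rewrite !gt_eqF.
  rewrite normrM normfV [`|a * b|]gtr0_norm ?mulr_gt0 // ltr_pdivrMr ?mulr_gt0 //.
  rewrite distrC; apply: (le_lt_trans ab); apply: (lt_le_trans hw).
  by rewrite ler_pM2l // expr2 ler_pM // ltW.
move=> z Kz; rewrite /rfun -real_complexM (max_idPl _) ?hd // mulVf //.
by rewrite gt_eqF // gK.
Qed.

End inversion_on_compact.

(** * Dominated series *)

Section dominated_series.
Context (R : realType).
Implicit Types (K : set (circle R)) (a b : fseries R).
Local Notation nc := (@Normc.normc R).

Lemma nneseries_fine_cvg (v : nat -> \bar R) : (forall n, 0 <= v n)%E ->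
  (\sum_(0 <= m <oo) v m < +oo)%E ->
  (forall n, v n \is a fin_num) /\ cvgn (series (fun n => fine (v n))).
Proof.
move=> v0 vS.
have vfin n : v n \is a fin_num.
  rewrite ge0_fin_numE //; apply: le_lt_trans vS.
  apply: le_trans (nneseries_lim_ge n.+1 (fun k _ _ => v0 k)).
  by rewrite big_nat_recr //= leeDr // sume_ge0.
split=> //; apply: nondecreasing_is_cvgn.
  by apply: nondecreasing_series => n _ _; exact: fine_ge0.
exists (fine (\sum_(0 <= m <oo) v m)%E) => _ [n _ <-].
have Sfin : (\sum_(0 <= m <oo) v m)%E \is a fin_num.
  by rewrite ge0_fin_numE //; exact: nneseries_ge0.
rewrite -lee_fin fineK // /series /= -sumEFin.
under eq_bigr do rewrite fineK //.
exact: nneseries_lim_ge.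
Qed.

(** Coefficients bounded by a summable sequence. *)
Definition dominated a := exists2 alpha : nat -> R,
  cvgn (series alpha) & forall m z, nc (a m z) <= alpha m.

Lemma algB_dominated a : algB a -> dominated a.
Proof.
move=> [ca sa].
have ns0 m : (0 <= norm_sup (a m))%E.
  apply: (@le_trans _ _ (nc (a m (expi 0)))%:E); first by rewrite lee_fin nc_ge0.
  by apply: ereal_sup_ubound; exists (expi 0).
have [nfin cv] := nneseries_fine_cvg ns0 sa.
exists (fun m => fine (norm_sup (a m))) => // m z.
by rewrite -lee_fin fineK //; apply: ereal_sup_ubound; exists z.
Qed.

Lemma norm1_ge0 (phi : circle R -> R[i]^o) : (0 <= norm1 phi)%E.
Proof. by apply: esum_ge0 => k _; rewrite lee_fin nc_ge0. Qed.

Lemma algA_wball a : algA a -> exists2 alpha : nat -> R,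
  cvgn (series alpha) & forall m, wball (alpha m) (a m).
Proof.
move=> [wa sa]; have [nfin cv] := nneseries_fine_cvg (fun m => norm1_ge0 (a m)) sa.
exists (fun m => fine (norm1 (a m))) => // m.
by apply: wiener_wball => //; rewrite fineK.
Qed.

Lemma sum_triangle (T : nmodType) (c : nat -> nat -> T) N :
  \sum_(k < N) \sum_(n < k.+1) c (k - n)%N n =
  \sum_(n < N) \sum_(m < (N - n)%N) c m n.
Proof.
elim: N => [|N IH]; first by rewrite !big_ord0.
rewrite big_ord_recr /= IH.
transitivity (\sum_(n < N.+1) (\sum_(m < (N - n)%N) c m n + c (N - n)%N n)).
  rewrite big_split /=; congr (_ + _).
  by rewrite big_ord_recr /= subnn big_ord0 addr0.
apply: eq_bigr => n _; rewrite subSn; last by rewrite -ltnS.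
by rewrite big_ord_recr.
Qed.

(** Summation along diagonals of a double array bounded by a product of
    summable sequences. *)
Lemma cvg_series_cauchy (c : nat -> nat -> R[i]^o) (alpha beta : nat -> R)
    (r : nat -> R[i]^o) (l : R[i]^o) :
  (forall n, 0 <= alpha n) -> (forall n, 0 <= beta n) ->
  cvgn (series alpha) -> cvgn (series beta) ->
  (forall m n, nc (c m n) <= alpha m * beta n) ->
  (forall n, series (c ^~ n) @ \oo --> r n) -> series r @ \oo --> l ->
  series (fun k => \sum_(n < k.+1) c (k - n)%N n) @ \oo --> l.
Proof.
move=> a0 b0 ca cb hc hr hl.
pose A := limn (series alpha); pose B := limn (series beta).
have A0 : 0 <= A.
  by apply: le_trans (series_le_lim 0 a0 ca); rewrite /series /= big_geq.
have B0 : 0 <= B.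
  by apply: le_trans (series_le_lim 0 b0 cb); rewrite /series /= big_geq.
(* remainder of the inner series after k terms *)
have hrem n k (e : R) : (forall m, (k <= m)%N -> \sum_(k <= j < m) alpha j <= e) ->
    nc (r n - series (c ^~ n) k) <= e * beta n.
  move=> he; apply: (nc_limn_le (hr n)); exists k => // m /= km.
  rewrite sub_series km; apply: (le_trans (nc_sum _ _ _)).
  apply: (@le_trans _ _ (\sum_(k <= j < m) alpha j * beta n)).
    by apply: ler_sum => j _; exact: hc.
  by rewrite -mulr_suml ler_wpM2r // he.
have sumA k m : (k <= m)%N -> \sum_(k <= j < m) alpha j <= A.
  move=> km; apply: (le_trans _ (series_le_lim m a0 ca)).
  by rewrite /series /= (big_cat_nat (leq0n k) km) //= lerDr sumr_ge0.
have sumB k : \sum_(j < k) beta j <= B.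
  by have := series_le_lim k b0 cb; rewrite /series /= big_mkord.
apply/cvgCP => e e0; pose d := e / (A + B + 2).
have AB0 : 0 < A + B + 2 by lra.
have d0 : 0 < d by rewrite divr_gt0.
have [M hM] := series_tail_le a0 ca d0.
have [M' hM'] := series_tail_le b0 cb d0.
have [M2 _ hM2] := (cvgCP _ _ _).1 hl _ d0.
exists (M + M' + M2)%N => // N /= hN.
have N1 : (M <= N)%N by apply: leq_trans hN; rewrite -addnA leq_addr.
have N2 : (M' <= N - M)%N by rewrite leq_subRL //; apply: leq_trans hN; rewrite leq_addr.
have N3 : (M2 <= N)%N by apply: leq_trans hN; rewrite leq_addl.
have hl' := hM2 N N3; rewrite /= in hl'.
set D := series _ N.
have DE : D = \sum_(n < N) series (c ^~ n) (N - n)%N.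
  rewrite /D /series /= big_mkord sum_triangle.
  by apply: eq_bigr => n _; rewrite big_mkord.
have h1 : nc (series r N - D) <= d * B + A * d.
  rewrite DE /series /= big_mkord -sumrB.
  apply: (le_trans (nc_sum _ _ _)).
  pose w (n : nat) : R := if (n < N - M)%N then d * beta n else A * beta n.
  apply: (@le_trans _ _ (\sum_(n < N) w n)).
    apply: ler_sum => n _; rewrite /w; case: ltnP => nM.
      apply: hrem => m; apply: hM.
      move: nM; clear; move: (nat_of_ord n) => k; lia.
    by apply: hrem => m; exact: sumA.
  rewrite -(big_mkord xpredT w) (big_cat_nat (leq0n (N - M)) (leq_subr M N)) /=.
  (* for n < N - M the inner remainder is small, for the other n it is [beta n] *)
  apply: lerD.
    rewrite big_mkord (eq_bigr (fun n : 'I__ => d * beta n)).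
      by rewrite -mulr_sumr; apply: ler_wpM2l; [exact: ltW|exact: sumB].
    by move=> n _; rewrite /w ltn_ord.
  rewrite (eq_big_nat _ _ (F2 := fun n => A * beta n)).
    by rewrite -mulr_sumr ler_wpM2l // hM' // leq_subr.
  by move=> n /andP[h _]; rewrite /w ltnNge h.
have -> : D - l = (series r N - l) - (series r N - D) by ring.
apply: (le_lt_trans (ncD _ _)); rewrite ncN.
have E : d * (A + B + 2) = e by rewrite /d mulfVK // gt_eqF.
by nra.
Qed.

End dominated_series.

(** * Function algebras on the circle *)

Section function_algebras.
Context (R : realType).
Implicit Types (K : set (circle R)) (a b : fseries R) (g h : circle R -> R[i]^o).
Local Notation nc := (@Normc.normc R).

(** The series with the single term [x^n phi]. *)
Definition monomial n (phi : circle R -> R[i]^o) : fseries R :=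
  fun m z => if m == n then phi z else 0.

(** The action of a series on a function defined on the whole circle. *)
Definition gact g a : circle R -> R[i]^o := fun z =>
  limn (series (fun m => g (circle_pow z (2 ^ m)) * a m z)).

(** A class [P] of functions on the circle and a class [Alg] of series with
    coefficients in [P] having the properties common to the pairs (W, A) and
    (C(T), B) on which the main results rest. *)
Record function_algebra (P : set (circle R -> R[i]^o)) (Alg : set (fseries R)) :
    Prop := {
  fa_cont : forall g, P g -> continuous g;
  fa_wball : forall C g, wball C g -> P g;
  fa_add : forall g h, P g -> P h -> P (fun z => g z + h z);
  fa_mul : forall g h, P g -> P h -> P (fun z => g z * h z);
  fa_conj : forall g, P g -> P (fun z => ((g z)^*)%C);
  fa_pow : forall n g, P g -> P (fun z => g (circle_pow z n));
  fa_dom : forall a, Alg a -> dominated a;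
  fa_act : forall g a, P g -> Alg a -> P (gact g a);
  fa_monomial : forall n g, P g -> Alg (monomial n g);
  fa_inv : forall K (g : circle R -> R), compact K -> P (rfun g) -> (forall z, 0 <= g z) ->
    (forall z, K z -> 0 < g z) ->
    exists u, P u /\ forall z, K z -> u z * rfun g z = 1 }.

(** Restrictions to [K] of the functions of class [P]. *)
Definition restrictions (P : set (circle R -> R[i]^o)) K : set (K -> R[i]^o) :=
  [set f | exists2 g, P g & f = g \o set_val].

Arguments restrictions P K _ : clear implicits.

Lemma norm1_cst0 : norm1 (fun=> 0 : R[i]^o) = 0%E :> \bar R.
Proof.
have [_ h] := wball_wiener (wball_cst (0 : R[i])).
by apply/eqP; rewrite eq_le norm1_ge0 andbT; move: h; rewrite nc0.
Qed.

Lemma norm_sup_cst0 : norm_sup (fun=> 0 : R[i]^o) = 0%E :> \bar R.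
Proof.
apply/eqP; rewrite eq_le; apply/andP; split.
  by apply: ge_ereal_sup => _ [z _ <-]; rewrite nc0.
by apply: ereal_sup_ubound; exists (expi 0); rewrite ?nc0.
Qed.

Lemma continuous_norm_sup g : continuous g -> (norm_sup g < +oo)%E.
Proof.
move=> /continuous_bounded[C _ hC]; apply: (@le_lt_trans _ _ C%:E); last exact: ltry.
by apply: ge_ereal_sup => _ [z _ <-]; rewrite lee_fin.
Qed.

Lemma monomial_nneseries (N : (circle R -> R[i]^o) -> \bar R) n g :
  (forall h, 0 <= N h)%E -> N (fun=> 0) = 0%E -> (N g < +oo)%E ->
  (\sum_(0 <= m <oo) N (monomial n g m) < +oo)%E.
Proof.
move=> N0 N00 Ng; rewrite (nneseries_split 0 n.+1) // add0n.
rewrite eseries0 ?adde0; last first.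
  by move=> k nk _; rewrite /monomial gtn_eqF // N00.
rewrite big_nat_recr //= big_nat big1 ?add0e; last first.
  by move=> k /andP[_ kn]; rewrite /monomial ltn_eqF // N00.
by rewrite /monomial eqxx.
Qed.

Lemma dominated_cvg g a z C : (forall z, nc (g z) <= C) -> dominated a ->
  series (fun m => g (circle_pow z (2 ^ m)) * a m z : R[i]^o) @ \oo --> gact g a z.
Proof.
move=> gC [al cal hal]; apply: cvgC_series (fun m => C * al m) _ _.
  by move=> m; rewrite ncM; apply: ler_pM; rewrite ?nc_ge0.
exact: is_cvg_seriesZ.
Qed.

Lemma continuous_unif g : (forall e : R, 0 < e -> exists h, continuous h /\
    forall z, nc (g z - h z) <= e) -> continuous g.
Proof.
move=> H; apply/continuous_circleP => z e e0.
have e4 : 0 < e / 4 by rewrite divr_gt0.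
have [h [/continuous_circleP ch hh]] := H _ e4.
have [d d0 hd] := ch z _ e4; exists d => // w /hd hw.
have -> : g w - g z = (g w - h w) + ((h w - h z) - (g z - h z)) by ring.
have := ncD (g w - h w) ((h w - h z) - (g z - h z)).
have := ncD (h w - h z) (- (g z - h z)).
by rewrite ncN; have := hh w; have := hh z; lra.
Qed.

Lemma continuous_pow g n : continuous g -> continuous (fun z => g (circle_pow z n)).
Proof.
move=> /continuous_circleP cg; apply/continuous_circleP => z d d0.
have [d1 d10 h1] := cg (circle_pow z n) d d0.
have [d2 d20 h2] := (continuous_circleP _).1 (@continuous_cvalX R n) z d1 d10.
by exists d2 => // w /h2 h3; apply: h1.
Qed.

Lemma gact_continuous g a : continuous g -> (forall m, continuous (a m)) ->
  dominated a -> continuous (gact g a).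
Proof.
move=> cg ca da; have [C C0 hC] := continuous_bounded cg.
have [al cal hal] := da.
have al0 m : 0 <= al m by exact: le_trans (nc_ge0 _) (hal m (expi 0)).
apply: continuous_unif => e e0.
have e1 : 0 < e / (C + 1) by rewrite divr_gt0 //; lra.
have [N hN] := series_tail_le al0 cal e1.
exists (fun z => \sum_(m <- iota 0 N) g (circle_pow z (2 ^ m)) * a m z); split.
  apply: (@continuous_sum R _ _ (fun m z => g (circle_pow z (2 ^ m)) * a m z)) => m.
  by apply: (continuous_mul (phi := fun z => g (circle_pow z (2 ^ m)))); [exact: continuous_pow|exact: ca].
move=> z; apply: (nc_limn_le (@dominated_cvg g a z C hC da)); exists N => // m /= Nm.
have -> : \sum_(m <- iota 0 N) g (circle_pow z (2 ^ m)) * a m z =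
  series (fun m => g (circle_pow z (2 ^ m)) * a m z : R[i]^o) N.
  by rewrite /series /= /index_iota subn0.
rewrite sub_series Nm; apply: (le_trans (nc_sum _ _ _)).
apply: (@le_trans _ _ (\sum_(N <= k < m) C * al k)).
  by apply: ler_sum => k _; rewrite ncM; apply: ler_pM; rewrite ?nc_ge0.
rewrite -mulr_sumr.
have h1 := ler_wpM2l C0 (hN N m (leqnn N) Nm).
apply: (le_trans h1); rewrite mulrCA ler_piMr ?(ltW e0) //.
by rewrite ler_pdivrMr; lra.
Qed.

Lemma function_algebra_wiener : function_algebra (@wiener R) algA.
Proof.
have wb g : wiener g -> exists C, wball C g by exact: wiener_ex_wball.
have bw C g : wball C g -> wiener g by move=> /wball_wiener[].
split.
- by move=> g [].
- exact: bw.
- by move=> g h /wb[C hC] /wb[D hD]; exact: bw (wballD hC hD).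
- by move=> g h /wb[C hC] /wb[D hD]; exact: bw (wballM hC hD).
- by move=> g /wb[C hC]; exact: bw (wball_conj hC).
- by move=> n g /wb[C hC]; exact: bw (wball_pow n hC).
- move=> a /algA_wball[al cal hal]; exists al => // m z.
  exact: wball_le.
- move=> g a /wb[C hC] /algA_wball[al cal hal].
  have h m := wballM (wball_pow (2 ^ m) hC) (hal m).
  apply: bw (wball_series h _ _); first exact: is_cvg_seriesZ.
  move=> z; apply: dominated_cvg (fun z => wball_le z hC) _.
  by exists al => // m w; exact: wball_le.
- move=> n g wg; split.
    move=> m; rewrite /monomial; case: (m == n); first exact: wg.
    exact: bw (wball_cst 0).
  by apply: monomial_nneseries; [exact: norm1_ge0|exact: norm1_cst0|case: wg].
- move=> K g cK /wb[C hC] g0 gK.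
  have [u [[D hD] hu]] := wiener_inv_on cK hC g0 gK.
  by exists u; split => //; exact: bw hD.
Qed.

Lemma function_algebra_continuous :
  function_algebra [set g : circle R -> R[i]^o | continuous g] algB.
Proof.
split => /=.
- by [].
- by move=> C g; exact: wball_continuous.
- by move=> g h; exact: continuous_add.
- by move=> g h; exact: continuous_mul.
- by move=> g; exact: continuous_conj.
- by move=> n g; exact: continuous_pow.
- exact: algB_dominated.
- by move=> g a cg Ba; exact: gact_continuous cg (proj1 Ba) (algB_dominated Ba).
- move=> n g cg; split.
    move=> m; rewrite /monomial; case: (m == n); first exact: cg.
    exact: continuous_const.
  apply: monomial_nneseries.
  + move=> h; apply: (@le_trans _ _ (nc (h (expi 0)))%:E).
      by rewrite lee_fin nc_ge0.
    by apply: ereal_sup_ubound; exists (expi 0).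
  + exact: norm_sup_cst0.
  + exact: continuous_norm_sup.
- by move=> K g cK cg _ gK; exact: continuous_inv_on.
Qed.

Lemma WK_restrictions K : WK K = restrictions (@wiener R) K.
Proof. by []. Qed.

(** By Tietze's theorem, applied to the real and imaginary parts. *)
Lemma CK_restrictions K : compact K ->
  CK K = restrictions [set g : circle R -> R[i]^o | continuous g] K.
Proof.
move=> cK; apply/seteqP; split => f /=; last first.
  move=> [g cg ->]; apply/continuous_subcircleP => z e e0.
  have [d d0 hd] := (continuous_circleP g).1 cg (set_val z) e e0.
  by exists d => // w /hd.
move=> /continuous_subcircleP cf.
have real_ext (r : K -> R) : (forall (z : K) (e : R), 0 < e -> exists2 d : R, 0 < d &
    forall w : K, nc (cval (set_val w) - cval (set_val z)) < d ->
    `|r w - r z| < e) -> exists2 g : circle R -> R, continuous (rfun g) &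
    forall z : K, g (set_val z) = r z.
  move=> cr; have cr' : continuous (r : K -> R^o).
    move=> z; apply: (@cvgrPdist_lt _ _ _ (nbhs z) _ r (r z)).2 => e e0.
    have [d d0 hd] := cr z e e0; apply: (nbhs_subcircleP _ _).2; exists d => // w /hd.
    by rewrite /= distrC.
  have cF := (@subspace_valL_continuousP' _ K _ (0 : R^o) (r : K -> R^o)).2 cr'.
  have /compact_bounded[M [_ hM]] := continuous_compact cF cK.
  pose M1 := Num.max 1 (M + 1).
  have M10 : 0 < M1 by rewrite /M1 lt_max ltr01.
  have [|g [gF cg _]] := continuous_bounded_extension (@circle_normal R)
    (compact_circle_closed cK) M10 cF.
    move=> z Kz; apply: hM; last by exists z.
    by rewrite /M1 lt_max ltrDl ltr01 orbT.
  exists g.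
    apply/rfun_continuousP => z e e0.
    have h := (@cvgrPdist_lt _ _ _ (nbhs z) (nbhs_filter z) g (g z)).1 (cg z) e e0.
    have [d d0 hd] := (nbhs_circleP _ _).1 h; exists d => // w /hd.
    by rewrite /= distrC.
  move=> z; rewrite -gF; last by apply/mem_set/set_valP.
  exact: (congr1 (fun f => f z) (@valLK _ _ (0 : R^o) K (r : K -> R^o))).
have [gr cgr hgr] : exists2 g : circle R -> R, continuous (rfun g) &
    forall z : K, g (set_val z) = complex.Re (f z).
  apply: real_ext => z e e0; have [d d0 hd] := cf z e e0; exists d => // w /hd.
  by apply: le_lt_trans; rewrite -raddfB; exact: Re_le_nc.
have [gi cgi hgi] : exists2 g : circle R -> R, continuous (rfun g) &
    forall z : K, g (set_val z) = complex.Im (f z).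
  apply: real_ext => z e e0; have [d d0 hd] := cf z e e0; exists d => // w /hd.
  by apply: le_lt_trans; rewrite -raddfB; exact: Im_le_nc.
exists (fun z => rfun gr z + 'i%C * rfun gi z).
  exact: continuous_add cgr (continuousMl (c := 'i%C) cgi).
by apply/funext => z; rewrite /= /rfun hgr hgi -complexE.
Qed.

End function_algebras.

Arguments restrictions {R} P K _.

(** * Module axioms *)

Section module_axioms.
Context (R : realType).
Implicit Types (a b : fseries R) (g h : circle R -> R[i]^o).
Local Notation nc := (@Normc.normc R).

Lemma cvg_series_lin (x y : nat -> R[i]^o) (k lx ly : R[i]^o) :
  series x @ \oo --> lx -> series y @ \oo --> ly ->
  series (fun m => k * x m + y m) @ \oo --> k * lx + ly.
Proof.
move=> hx hy.
have -> : series (fun m => k * x m + y m) = (fun n => k * series x n + series y n).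
  by apply/funext => n; rewrite /series /= big_split /= mulr_sumr.
by apply: cvgD hy; apply: cvgM hx; exact: cvg_cst.
Qed.

Lemma gact_linl (k : R[i]^o) g h a z C D : (forall z, nc (g z) <= C) ->
  (forall z, nc (h z) <= D) -> dominated a ->
  gact (fun z => k * g z + h z) a z = k * gact g a z + gact h a z.
Proof.
move=> gC hD da; apply: cvgC_uniq.
rewrite (_ : (fun m => _) = (fun m => k * (g (circle_pow z (2 ^ m)) * a m z) +
    h (circle_pow z (2 ^ m)) * a m z)); last first.
  by apply/funext => m; rewrite mulrDl mulrA.
exact: cvg_series_lin (@dominated_cvg _ g a z C gC da)
  (@dominated_cvg _ h a z D hD da).
Qed.

Lemma gact_linr (k : R[i]^o) g a b z C : (forall z, nc (g z) <= C) ->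
  dominated a -> dominated b ->
  gact g (fun m z => k * a m z + b m z) z = k * gact g a z + gact g b z.
Proof.
move=> gC da db; apply: cvgC_uniq.
rewrite (_ : (fun m => _) = (fun m => k * (g (circle_pow z (2 ^ m)) * a m z) +
    g (circle_pow z (2 ^ m)) * b m z)); last first.
  by apply/funext => m; rewrite mulrDr mulrCA.
exact: cvg_series_lin (@dominated_cvg _ g a z C gC da)
  (@dominated_cvg _ g b z C gC db).
Qed.

(** Associativity of the action is summation by diagonals. *)
Lemma gact_mul g a b z C D : (forall z, nc (g z) <= C) ->
  (forall z, nc (gact g a z) <= D) -> dominated a -> dominated b ->
  gact (gact g a) b z = gact g (fmul a b) z.
Proof.
move=> gC gD da db; apply/esym/cvgC_uniq.
have [al cal hal] := da; have [be cbe hbe] := db.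
have al0 m : 0 <= al m by exact: le_trans (nc_ge0 _) (hal m (expi 0)).
have be0 m : 0 <= be m by exact: le_trans (nc_ge0 _) (hbe m (expi 0)).
have C0 : 0 <= C by exact: le_trans (nc_ge0 _) (gC (expi 0)).
pose c m n : R[i]^o := g (circle_pow z (2 ^ (n + m))) * a m (circle_pow z (2 ^ n)) * b n z.
have := @cvg_series_cauchy _ c (fun m => C * al m) be
  (fun n => gact g a (circle_pow z (2 ^ n)) * b n z) (gact (gact g a) b z).
have -> : series (fun k => \sum_(n < k.+1) c (k - n)%N n) =
  series (fun m => g (circle_pow z (2 ^ m)) * fmul a b m z).
  congr series; apply/funext => k; rewrite /fmul mulr_sumr.
  by apply: eq_bigr => n _; rewrite /c subnKC ?mulrA // -ltnS.
apply => //.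
- by move=> n; rewrite mulr_ge0.
- exact: is_cvg_seriesZ.
- move=> m n; rewrite /c !ncM; apply: ler_pM; rewrite ?mulr_ge0 ?nc_ge0 //.
  by apply: ler_pM; rewrite ?nc_ge0.
- move=> n.
  have h := @dominated_cvg _ g a (circle_pow z (2 ^ n)) C gC da.
  have -> : series (c ^~ n) = (fun N => series (fun m =>
     g (circle_pow (circle_pow z (2 ^ n)) (2 ^ m)) * a m (circle_pow z (2 ^ n)) : R[i]^o) N * b n z).
    apply/funext => N; rewrite /series /= mulr_suml; apply: eq_bigr => m _.
    by rewrite /c circle_powM expnD.
  by apply: cvgM h _; exact: cvg_cst.
- exact: (@dominated_cvg _ (gact g a) b z D gD db).
Qed.

Lemma circle_pow1 (z : circle R) : circle_pow z (2 ^ 0) = z.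
Proof. by apply: cval_inj; rewrite cval_pow expn0 expr1. Qed.

(** A series whose terms vanish but for one index. *)
Lemma series_single (x : nat -> R[i]^o) n : (forall m, m != n -> x m = 0) ->
  series x @ \oo --> x n.
Proof.
move=> hx; apply/cvgCP => e e0; exists n.+1 => // N /= nN.
rewrite /series /= big_mkord (bigD1 (Ordinal nN)) //= big1 ?addr0 ?subrr ?nc0 //.
by move=> j jn; apply: hx.
Qed.

Lemma gact_monomial g n (phi : circle R -> R[i]^o) z :
  gact g (monomial n phi) z = g (circle_pow z (2 ^ n)) * phi z.
Proof.
apply: cvgC_uniq.
have := @series_single (fun m => g (circle_pow z (2 ^ m)) * monomial n phi m z) n.
rewrite /monomial eqxx; apply => m /negPf ->; exact: mulr0.
Qed.

Lemma gact_one g z : gact g fone z = g z.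
Proof.
apply: cvgC_uniq.
have := @series_single (fun m => g (circle_pow z (2 ^ m)) * fone m z) 0%N.
rewrite /fone eqxx mulr1 circle_pow1; apply => m /negPf ->; exact: mulr0.
Qed.

Section axioms.
Variables (P : set (circle R -> R[i]^o)) (Alg : set (fseries R)).
Hypothesis PA : function_algebra P Alg.
Variables (K : set (circle R)) (sqK : square_closed K).

Lemma actE g a : act sqK (g \o set_val) a = gact g a \o set_val.
Proof. by []. Qed.

Lemma fa_bounded g : P g -> exists2 C : R, 0 <= C & forall z, nc (g z) <= C.
Proof. by move=> /(fa_cont PA); exact: continuous_bounded. Qed.

Lemma fa_cst (c : R[i]) : P (fun=> c).
Proof. exact: fa_wball PA _ _ (wball_cst c). Qed.

Lemma right_module_restrictions :
  right_module Alg fmul fone (act sqK) (restrictions P K).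
Proof.
split.
- by exists (fun=> 0) => //; exact: fa_cst.
- by move=> _ _ [g Pg ->] [h Ph ->]; exists (fun z => g z + h z) => //; exact: fa_add PA _ _ Pg Ph.
- move=> k _ [g Pg ->]; exists (fun z => k * g z) => //.
  exact: fa_mul PA _ _ (fa_cst k) Pg.
- move=> _ a [g Pg ->] Aa; exists (gact g a); last exact: actE.
  exact: fa_act PA _ _ Pg Aa.
- move=> k _ _ a [g Pg ->] [h Ph ->] Aa.
  have [C _ hC] := fa_bounded Pg; have [D _ hD] := fa_bounded Ph.
  apply/funext => z.
  exact: (gact_linl k (set_val z) hC hD (fa_dom PA Aa)).
- move=> k _ a b [g Pg ->] Aa Ab; have [C _ hC] := fa_bounded Pg.
  apply/funext => z.
  exact: (gact_linr k (set_val z) hC (fa_dom PA Aa) (fa_dom PA Ab)).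
- move=> _ a b [g Pg ->] Aa Ab; have [C _ hC] := fa_bounded Pg.
  have [D _ hD] := fa_bounded (fa_act PA Pg Aa).
  apply/funext => z.
  exact: (gact_mul (set_val z) hC hD (fa_dom PA Aa) (fa_dom PA Ab)).
- by move=> _ [g Pg ->]; rewrite actE; apply/funext => z; exact: gact_one.
Qed.

End axioms.

End module_axioms.

(** * Irreducibility and infinite dimension *)

Section irreducibility.
Context (R : realType).
Implicit Types (a b : fseries R) (g h : circle R -> R[i]^o) (K L : set (circle R)).
Local Notation nc := (@Normc.normc R).

(** The set of iterated squares of [z]. *)
Definition orbit z : set (circle R) := range (fun n => circle_pow z (2 ^ n)).

Lemma orbit_closureP z w : closure (orbit z) w <-> forall e : R, 0 < e ->
  exists n, nc (cval (circle_pow z (2 ^ n)) - cval w) < e.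
Proof.
split=> [h e e0|h U /nbhs_circleP[e e0 hU]].
  have : nbhs w [set u | nc (cval u - cval w) < e].
    by apply/nbhs_circleP; exists e.
  by move=> /h[_ [[n _ <-] hn]]; exists n.
have [n hn] := h e e0; exists (circle_pow z (2 ^ n)); split; last exact: hU.
by exists n.
Qed.

Lemma orbit_closure_square_closed z : square_closed (closure (orbit z)).
Proof.
move=> w hw; apply/orbit_closureP => e e0.
have [d d0 hd] := (continuous_circleP _).1 (@continuous_cvalX R 2) w e e0.
have [n hn] := (orbit_closureP z w).1 hw d d0; exists n.+1.
by have := hd _ hn; rewrite expnSr -circle_powM.
Qed.

Lemma orbit_closure_compact z : compact (closure (orbit z)).
Proof. by apply: closed_circle_compact; exact: closed_closure. Qed.

Lemma orbit_closure_self z : closure (orbit z) z.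
Proof.
apply/orbit_closureP => e e0; exists 0%N.
by rewrite circle_pow1 subrr nc0.
Qed.

(** In a minimal set every orbit is dense. *)
Lemma mu_set_orbit K z : mu_set K -> K z -> closure (orbit z) = K.
Proof.
move=> muK Kz; apply: (mu_minimal muK).
- by exists z; exact: orbit_closure_self.
- exact: orbit_closure_compact.
- exact: orbit_closure_square_closed.
- have cK : closed K by apply: compact_circle_closed; exact: mu_compact muK.
  rewrite closureE => w; apply; split => // _ [n _ <-].
  exact: square_closed_pow2 (mu_square muK) n z Kz.
Qed.

Section fixed_class.
Variables (P : set (circle R -> R[i]^o)) (Alg : set (fseries R)).
Hypothesis PA : function_algebra P Alg.
Variables (K : set (circle R)) (muK : mu_set K).

Local Notation act := (act (mu_square muK)).

Lemma submodule_sum (S : set (K -> R[i]^o)) (I : Type) (r : seq I)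
    (F : I -> K -> R[i]^o) :
  submodule Alg act (restrictions P K) S -> (forall i, S (F i)) ->
  S (fun z => \sum_(i <- r) F i z).
Proof.
move=> subS SF; elim: r => [|i r IH].
  rewrite (_ : (fun z => _) = 0); first exact: submod_zero subS.
  by apply/funext => z; rewrite big_nil.
have h1 := submod_diff subS (submod_zero subS) IH.
have := submod_diff subS (SF i) h1.
congr S; apply/funext => z; rewrite big_cons.
by rewrite -[LHS]/(F i z - (0 - _)) sub0r opprK.
Qed.

Lemma submodule_mul (S : set (K -> R[i]^o)) n g h :
  submodule Alg act (restrictions P K) S -> S (g \o set_val) -> P h ->
  S ((fun z => g (circle_pow z (2 ^ n)) * h z) \o set_val).
Proof.
move=> subS Sg Ph.
have := submod_act subS Sg (fa_monomial PA n Ph).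
by congr S; apply/funext => z; exact: gact_monomial.
Qed.

(** Given [f = g|K] non-zero in a submodule, every orbit in [K] meets the open
    set where [g] does not vanish; by compactness finitely many functions
    [|g (z^(2^n))|^2], all in the submodule, have a positive sum [G] on [K].
    As [G] is invertible on [K], the submodule is everything. *)
Lemma irreducible_restrictions : irreducible_module Alg act (restrictions P K).
Proof.
have P1 : P (fun=> 1) by exact: (fa_cst PA 1).
have [z1 Kz1] := mu_nonempty muK.
have z1K : z1 \in K by exact: mem_set.
split.
  exists ((fun=> 1) \o set_val), (monomial 0 (fun=> 1)); split.
  - by exists (fun=> 1).
  - exact: fa_monomial PA _ _ P1.
  - move=> /(congr1 (fun f => f (SigSub z1K : K))) /eqP.
    rewrite -[X in X == _]/(gact (fun=> 1) (monomial 0 (fun=> 1)) z1).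
    by rewrite gact_monomial mulr1 oner_eq0.
move=> S subS.
have [S0|/existsNP[f /not_implyP[Sf f0]]] := pselect (forall f, S f -> f = 0).
  left; apply/seteqP; split => f /=; first exact: S0.
  by move=> ->; exact: submod_zero subS.
right; apply/seteqP; split; first exact: submod_sub subS.
have [g Pg fE] := submod_sub subS Sf; rewrite {}fE in Sf f0.
have cg := fa_cont PA Pg.
have [z0 gz0] : exists z0 : K, g (set_val z0) != 0.
  apply: contrapT => h; apply: f0; apply/funext => z /=.
  by apply/eqP/negPn/negP => gz; apply: h; exists z.
have ex_n z : exists n, K z -> g (circle_pow z (2 ^ n)) != 0.
  have [Kz|nKz] := pselect (K z); last by exists 0%N.
  have e0 : 0 < nc (g (set_val z0)).
    by rewrite lt_neqAle nc_ge0 andbT eq_sym; apply: contra gz0 => /eqP/nc_eq0 ->.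
  have [d d0 hd] := (continuous_circleP g).1 cg (set_val z0) _ e0.
  have h : closure (orbit z) (set_val z0).
    by rewrite (mu_set_orbit muK Kz); exact: set_valP.
  have [n /hd hn] := (orbit_closureP _ _).1 h d d0; exists n => _.
  by apply/eqP => E; move: hn; rewrite E sub0r ncN ltxx.
have [n hn] := choice ex_n.
pose V z := [set w | 0 < nc (g (circle_pow w (2 ^ n z))) ^+ 2].
have Pgc m : P (fun z => ((g (circle_pow z (2 ^ m)))^*)%C).
  exact: fa_conj PA _ (fa_pow PA _ Pg).
have PG m : P (rfun (fun w => nc (g (circle_pow w (2 ^ m))) ^+ 2)).
  have := fa_mul PA (fa_pow PA (2 ^ m) Pg) (Pgc m).
  by congr P; apply/funext => z; rewrite /rfun nc_sqr.
have [s hs] : exists s : seq (circle R), forall z, K z -> exists2 w, w \in s & V w z.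
  apply: compact_finite_cover (mu_compact muK) _ => z Kz.
  apply: open_nbhs_nbhs; split; first exact: open_pos (fa_cont PA (PG (n z))).
  rewrite /V /= exprn_gt0 // lt_neqAle nc_ge0 andbT eq_sym.
  by apply: contra (hn z Kz) => /eqP/nc_eq0 ->.
pose t := undup s.
pose G z : R := \sum_(w <- t) nc (g (circle_pow z (2 ^ n w))) ^+ 2.
have G0 z : 0 <= G z by apply: sumr_ge0 => w _; exact: sqr_ge0.
have GK z : K z -> 0 < G z.
  move=> /hs[w ws Vw]; rewrite /G (bigD1_seq w) ?undup_uniq ?mem_undup //=.
  by apply: (lt_le_trans Vw); rewrite lerDl sumr_ge0 // => v _; exact: sqr_ge0.
have GE : rfun G = fun z => \sum_(w <- t) rfun (fun z => nc (g (circle_pow z (2 ^ n w))) ^+ 2) z.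
  by apply/funext => z; rewrite /rfun /G real_complex_sum.
have PGG : P (rfun G).
  rewrite GE; elim: (t) => [|w r IH].
    rewrite (_ : (fun z => _) = (fun=> 0)); first exact: (fa_cst PA 0).
    by apply/funext => z; rewrite big_nil.
  have := fa_add PA (PG (n w)) IH.
  by congr P; apply/funext => z; rewrite big_cons.
have SG : S (rfun G \o set_val).
  have -> : rfun G \o set_val = fun z : K => \sum_(w <- t)
      rfun (fun z => nc (g (circle_pow z (2 ^ n w))) ^+ 2) (set_val z).
    by rewrite GE.
  apply: (submodule_sum (F := fun w (z : K) =>
    rfun (fun z => nc (g (circle_pow z (2 ^ n w))) ^+ 2) (set_val z)) t subS) => w.
  have := submodule_mul (n w) subS Sf (Pgc (n w)).
  by congr S; apply/funext => z; rewrite /= /rfun nc_sqr.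
have [u [Pu hu]] := fa_inv PA (mu_compact muK) PGG G0 GK.
move=> _ [h Ph ->].
have := submodule_mul 0 subS SG (fa_mul PA Pu Ph).
congr S; apply/funext => z /=.
by rewrite circle_pow1 mulrA [rfun G _ * _]mulrC hu ?mul1r //; exact: set_valP.
Qed.

(** The monomials [z^i] are independent on an infinite set: by the dimension
    argument some non-zero polynomial would vanish on [K]. *)
Lemma infinite_dimensional_restrictions :
  infinite_set K -> infinite_dimensional (restrictions P K).
Proof.
move=> infK [n [e [Me span]]].
have PX (i : nat) : P (fun z => cval z ^+ i).
  have := fa_wball PA (wball_char (1 : R[i]) i%:Z).
  by congr P; apply/funext => z; rewrite mul1r.
have spanX (i : 'I_n.+1) : exists c : 'I_n -> R[i],
    (fun z : K => cval (set_val z) ^+ i : R[i]^o) = \sum_(j < n) c j *: e j.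
  by apply: span; exists (fun z => cval z ^+ i).
have [c hc] := choice spanX.
pose A : 'M[R[i]]_(n.+1, n) := \matrix_(i, j) c i j.
have kA : kermx A != 0.
  by rewrite -mxrank_eq0 mxrank_ker subn_eq0 -ltnNge ltnS rank_leq_col.
have [v vA v0] : exists2 v : 'rV_n.+1, v *m A = 0 & v != 0.
  have /rowV0Pn[v vk v0] := kA; exists v => //.
  exact/sub_kermxP.
pose p : {poly R[i]} := \poly_(i < n.+1) v ord0 (inord i).
have p0 : p != 0.
  apply: contra v0 => /eqP E; apply/eqP/rowP => i.
  have := congr1 (fun q : {poly R[i]} => q`_i) E.
  by rewrite coef_poly ltn_ord inord_val coef0 mxE [ord0]ord1.
have rt z : K z -> root p (cval z).
  move=> Kz; apply/rootP; rewrite horner_poly.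
  have zK : z \in K by exact: mem_set.
  transitivity (\sum_(i < n.+1) v ord0 i * \sum_(j < n) c i j * e j (SigSub zK)).
    apply: eq_bigr => i _; rewrite inord_val; congr (_ * _).
    have := congr1 (fun f => f (SigSub zK : K)) (hc i).
    by rewrite /= fct_sumE.
  under eq_bigr do rewrite mulr_sumr.
  rewrite exchange_big /= big1 // => j _.
  under eq_bigr do rewrite mulrA.
  rewrite -mulr_suml.
  have -> : \sum_(i < n.+1) v ord0 i * c i j = (v *m A) ord0 j.
    by rewrite mxE; apply: eq_bigr => i _; rewrite mxE.
  by rewrite vA mxE mul0r.
have [r rK sr] := infinite_set_fset (size p) infK.
have allr : all (root p) [seq cval z | z <- finmap.enum_fset r].
  by apply/allP => _ /mapP[z zr ->]; apply: rt; exact: rK.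
have := max_poly_roots p0 allr.
rewrite size_map map_inj_uniq ?finmap.fset_uniq; last exact: cval_inj.
by move=> /(_ isT); rewrite ltnNge sr.
Qed.

End fixed_class.

End irreducibility.

(** * Recurrent points and equidistribution *)

Section recurrence.
Context (R : realType).
Implicit Types (z w : circle R) (K L : set (circle R)) (phi psi : circle R -> R[i]^o).
Local Notation nc := (@Normc.normc R).

(** Uniform recurrence: the squaring map brings [z] back within [e] of itself at
    all multiples of some time [p]. *)
Definition recurrent z := forall e : R, 0 < e ->
  exists2 p, (0 < p)%N & forall k, nc (cval (circle_pow z (2 ^ (k * p))) - cval z) < e.

(** Points of infinite order in the circle group. *)
Definition not_root_of_unity z := forall n, (0 < n)%N -> cval z ^+ n != 1.

Lemma nc_pow_lipschitz z w m :
  nc (cval (circle_pow z m) - cval (circle_pow w m)) <= m%:R * nc (cval z - cval w).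
Proof.
rewrite !cval_pow; elim: m => [|m IH]; first by rewrite !expr0 subrr nc0 mul0r.
rewrite !exprS.
have -> : cval z * cval z ^+ m - cval w * cval w ^+ m =
  (cval z - cval w) * cval z ^+ m + cval w * (cval z ^+ m - cval w ^+ m) by ring.
apply: (le_trans (ncD _ _)); rewrite !ncM ncX !nc_cval expr1n mulr1 mul1r.
by rewrite -natr1 mulrDl mul1r addrC lerD2r.
Qed.

Lemma recurrent_pow z q : recurrent z -> recurrent (circle_pow z q).
Proof.
move=> rz e e0; have q0 : 0 < q%:R + 1 :> R by rewrite ltr_wpDl.
have [p p0 hp] := rz _ (divr_gt0 e0 q0); exists p => // k.
have -> : circle_pow (circle_pow z q) (2 ^ (k * p)) =
    circle_pow (circle_pow z (2 ^ (k * p))) q by rewrite !circle_powM mulnC.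
apply: (le_lt_trans (nc_pow_lipschitz _ _ _)).
have h := hp k; rewrite ltr_pdivlMr // in h.
have := nc_ge0 (cval (circle_pow z (2 ^ (k * p))) - cval z).
move: h; set x := nc _; have : 0 <= q%:R :> R by [].
by move: (q%:R : R) => y y0 h x0; nra.
Qed.

Lemma not_root_of_unity_pow z q : (0 < q)%N -> not_root_of_unity z ->
  not_root_of_unity (circle_pow z q).
Proof. by move=> q0 hz n n0; rewrite cval_pow -exprM hz // muln_gt0 q0. Qed.

Lemma closed_near K z : closed K ->
  (forall e : R, 0 < e -> exists2 w, K w & nc (cval w - cval z) < e) -> K z.
Proof.
move=> cK h; apply: cK => U /nbhs_circleP[e e0 hU].
by have [w Kw hw] := h e e0; exists w; split => //; exact: hU.
Qed.

(** The orbit closure of a uniformly recurrent point is minimal. *)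
Lemma recurrent_mu_set z : recurrent z -> mu_set (closure (orbit z)).
Proof.
move=> rz; split.
- by exists z; exact: orbit_closure_self.
- exact: orbit_closure_compact.
- exact: orbit_closure_square_closed.
move=> L [w Lw] cL sqL LK; have clL : closed L by exact: compact_circle_closed.
suff Lz : L z.
  apply/seteqP; split => // u hu; apply: closed_near clL _ => e e0.
  have [n hn] := (orbit_closureP z u).1 hu e e0.
  by exists (circle_pow z (2 ^ n)) => //; exact: square_closed_pow2.
apply: closed_near clL _ => e e0; have e2 : 0 < e / 2 by rewrite divr_gt0.
have [p p0 hp] := rz _ e2.
have d0 : 0 < e / 2 / (2 ^ p)%:R by rewrite divr_gt0 // ltr0n expn_gt0.
have [n hn] := (orbit_closureP z w).1 (LK _ Lw) _ d0.
(* wait until the next multiple of [p] *)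
pose r := (p - n %% p)%N.
have rp : (r <= p)%N by exact: leq_subr.
have [k nr] : exists k, (n + r = k * p)%N.
  exists (n %/ p).+1; rewrite {1}(divn_eq n p) /r -addnA subnKC ?mulSn 1?addnC //.
  by rewrite ltnW // ltn_mod.
exists (circle_pow w (2 ^ r)); first exact: square_closed_pow2.
have h1 := hp k; rewrite -nr expnD -circle_powM in h1.
have h2 := nc_pow_lipschitz (circle_pow z (2 ^ n)) w (2 ^ r).
have h3 : (2 ^ r)%:R * nc (cval (circle_pow z (2 ^ n)) - cval w) < e / 2.
  apply: (@le_lt_trans _ _ ((2 ^ p)%:R * nc (cval (circle_pow z (2 ^ n)) - cval w))).
    by rewrite ler_wpM2r ?nc_ge0 // ler_nat leq_pexp2l.
  by rewrite mulrC -ltr_pdivlMr // ltr0n expn_gt0.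
set A := cval (circle_pow (circle_pow z (2 ^ n)) (2 ^ r)) in h1 h2.
have -> : cval (circle_pow w (2 ^ r)) - cval z =
  (A - cval z) - (A - cval (circle_pow w (2 ^ r))) by ring.
by have := ncD (A - cval z) (- (A - cval (circle_pow w (2 ^ r)))); rewrite ncN; lra.
Qed.

Lemma orbit_inj z : not_root_of_unity z ->
  injective (fun n => circle_pow z (2 ^ n)).
Proof.
move=> hz; suff H a b : (a < b)%N -> circle_pow z (2 ^ a) <> circle_pow z (2 ^ b).
  by move=> a b; case: (ltngtP a b) => // /H // h /esym.
move=> ab /(congr1 (@cval R)); rewrite !cval_pow => E.
have lt2 : (2 ^ a < 2 ^ b)%N by rewrite ltn_exp2l.
have := hz (2 ^ b - 2 ^ a)%N; rewrite subn_gt0 lt2 => /(_ isT)/eqP; apply.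
have nz := expf_neq0 (2 ^ a) (cval_neq0 z).
by apply: (mulfI nz); rewrite -exprD subnKC ?mulr1 // ltnW.
Qed.

Lemma orbit_closure_infinite z : not_root_of_unity z ->
  infinite_set (closure (orbit z)).
Proof.
move=> /orbit_inj oi; apply: (@sub_infinite_set _ (orbit z)).
  exact: subset_closure.
rewrite /orbit (eq_finite_set (inj_card_eq _)); first exact: infinite_nat.
by move=> i j _ _; exact: oi.
Qed.

(** Mean of [phi] over the first [n + 1] powers of [z]. *)
Definition average z phi n : R[i]^o :=
  (((n.+1)%:R^-1)%:C)%C * \sum_(q < n.+1) phi (circle_pow z q.+1).

(** Equidistribution of the powers of a point of infinite order: the averages
    of non-trivial characters are geometric sums. *)
Lemma average_char z (k : int) : not_root_of_unity z -> k != 0 ->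
  average z (fun w => cval w ^ k) @ \oo --> (0 : R[i]^o).
Proof.
move=> hz k0; set v := cval z ^ k.
have v1 : v - 1 != 0.
  rewrite subr_eq0 /v; case: k k0 {v} => n n0.
    by rewrite -exprnP hz // lt0n.
  by rewrite NegzE -exprnN invr_eq1 hz.
have nv : 0 < nc (v - 1).
  by rewrite lt_neqAle nc_ge0 andbT eq_sym; apply: contra v1 => /eqP/nc_eq0 ->.
apply/cvgCP => e e0.
have [N hN] := ltr_add_invr (divr_gt0 (mulr_gt0 e0 nv) (ltr0n R 2)).
exists N => // n /= Nn; rewrite subr0 /average.
have -> : \sum_(q < n.+1) cval (circle_pow z q.+1) ^ k = v * (v ^+ n.+1 - 1) / (v - 1).
  apply: (mulIf v1); rewrite mulfVK // subrX1 [LHS]mulrC [RHS]mulrCA.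
  congr (_ * _); rewrite mulr_sumr; apply: eq_bigr => q _.
  by rewrite cval_pow exprnP exprz_exp mulrC -exprz_exp -exprnP exprS.
rewrite !ncM nc_real ncV nc_cvalXz mul1r ger0_norm ?invr_ge0 //.
have h1 : nc (v ^+ n.+1 - 1) <= 2.
  by apply: (le_trans (ncD _ _)); rewrite ncN ncX nc_cvalXz expr1n nc1.
rewrite mulrA ltr_pdivrMr //.
have h2 : n.+1%:R^-1 < e * nc (v - 1) / 2 :> R.
  move: hN; rewrite add0r; apply: le_lt_trans.
  by rewrite lef_pV2 ?posrE // ler_nat ltnS.
have h3 : 0 <= n.+1%:R^-1 :> R by rewrite invr_ge0.
by move: h2 h3; set t := n.+1%:R^-1; nra.
Qed.

Lemma cmean_tpoly_cons (x : R[i] * int) s :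
  cmean (tpoly (x :: s)) = x.1 * (x.2 == 0)%:R + cmean (tpoly s).
Proof.
rewrite (_ : tpoly _ = fun z => x.1 * cval z ^ x.2 + tpoly s z).
  rewrite cmeanD; [|exact/continuousMl/continuous_cvalXz|exact: continuous_tpoly].
  by rewrite cmeanZ ?cmean_expXz //; exact: continuous_cvalXz.
by apply/funext => z; rewrite /tpoly big_cons.
Qed.

Lemma average_tpoly z s : not_root_of_unity z ->
  average z (tpoly s) @ \oo --> cmean (tpoly s).
Proof.
move=> hz; elim: s => [|x s IH].
  have -> : average z (tpoly [::]) = fun=> 0.
    apply/funext => n; rewrite /average big1 ?mulr0 // => q _.
    by rewrite /tpoly big_nil.
  have -> : cmean (tpoly [::]) = 0 :> R[i]^o.
    have := cmean_expXz R 1; rewrite (_ : tpoly _ = fun z => 0 * cval z ^ 1).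
      by rewrite cmeanZ ?mul0r //; exact: continuous_cvalXz.
    by apply/funext => w; rewrite /tpoly big_nil mul0r.
  exact: (@cvg_cst R[i]^o).
rewrite cmean_tpoly_cons.
have -> : average z (tpoly (x :: s)) =
    fun n => x.1 * average z (fun w => cval w ^ x.2) n + average z (tpoly s) n.
  apply/funext => n; rewrite /average mulrCA -mulrDr; congr (_ * _).
  rewrite mulr_sumr -big_split /=; apply: eq_bigr => q _.
  by rewrite /tpoly big_cons.
apply: cvgD IH; apply: cvgM; first exact: cvg_cst.
have [->|k0] := eqVneq x.2 0; last exact: average_char.
rewrite (_ : average _ _ = fun=> 1); first exact: (@cvg_cst R[i]^o).
apply/funext => n; rewrite /average (eq_bigr (fun=> 1)) //.
by rewrite sumr_const card_ord -real_complex_nat -real_complexM mulVf.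
Qed.

(** The averages over the powers tend to the mean. *)
Lemma cmean_eq0_powers z psi : not_root_of_unity z -> continuous psi ->
  (forall q, (0 < q)%N -> psi (circle_pow z q) = 0) -> cmean psi = 0.
Proof.
move=> hz cpsi h0; apply: nc_eq0; apply/eqP; rewrite eq_le nc_ge0 andbT.
apply/ler_addgt0Pr => e e0; rewrite add0r.
have e2 : 0 < e / 2 by rewrite divr_gt0.
have [n hn] := kmean_cvg cpsi e2; set s := kmean psi n in hn.
have h1 : nc (cmean psi - cmean (tpoly s)) <= e / 2.
  have cs := @continuous_tpoly R s.
  rewrite -(cmeanB cpsi cs) -(rmean_cst (e / 2)); apply: nc_cmean_le hn.
    exact: continuous_sub cpsi cs.
  exact: rcont_cst.
have h2 : nc (cmean (tpoly s)) <= e / 2.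
  rewrite -[cmean _]subr0; apply: (nc_limn_le (@average_tpoly z s hz)); exists 0%N => // N _ /=.
  rewrite subr0 /average ncM nc_real ger0_norm ?invr_ge0 //.
  rewrite mulrC ler_pdivrMr //; apply: (le_trans (nc_sum _ _ _)).
  rewrite mulr_natr -[X in _ *+ X]card_ord -sumr_const; apply: ler_sum => q _.
  by have := hn (circle_pow z q.+1); rewrite h0 // sub0r ncN.
have := ncD (cmean psi - cmean (tpoly s)) (cmean (tpoly s)); rewrite subrK; lra.
Qed.

(** All products with characters have mean zero; conclude by Fourier inversion. *)
Lemma continuous_eq0_powers z phi : not_root_of_unity z -> continuous phi ->
  (forall q, (0 < q)%N -> phi (circle_pow z q) = 0) -> forall w, phi w = 0.
Proof.
move=> hz cphi h0 w.
have F0 k : fourier phi k = 0.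
  rewrite fourierE; apply: (cmean_eq0_powers hz); first exact: continuous_char.
  by move=> q q0; rewrite h0 // mul0r.
apply: nc_eq0; apply/eqP; rewrite eq_le nc_ge0 andbT.
apply/ler_addgt0Pr => e e0; rewrite add0r.
have [n hn] := kmean_cvg cphi e0; have := hn w.
suff -> : tpoly (kmean phi n) w = 0 by rewrite subr0.
by rewrite /tpoly big_map big1 // => j _; rewrite F0 mulr0 mul0r.
Qed.

End recurrence.

(** * A recurrent point of infinite order *)

(** Adding a multiple of [2^J] preserves the 2-adic valuation of [x < 2^J]. *)
Lemma logn2_shift J k x : (0 < x < 2 ^ J)%N ->
  logn 2 (x + k * 2 ^ J) = logn 2 x.
Proof.
move=> /andP[x0 xJ]; have [b cb xE] := pfactor_coprime (isT : prime 2) x0.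
set v := logn 2 x in xE *.
have b0 : (0 < b)%N by move: x0; rewrite xE muln_gt0 => /andP[].
have vJ : (v < J)%N.
  rewrite -(ltn_exp2l _ _ (isT : (1 < 2)%N)); apply: leq_ltn_trans xJ.
  by rewrite xE leq_pmull.
have JE : (2 ^ J = 2 ^ (J - v).-1 * 2 * 2 ^ v)%N.
  by rewrite -mulnA -expnS -expnD; congr (2 ^ _)%N; lia.
have -> : (x + k * 2 ^ J = (b + k * 2 ^ (J - v).-1 * 2) * 2 ^ v)%N.
  by rewrite {1}xE JE mulnDl !mulnA.
rewrite lognM ?expn_gt0 //; last by rewrite addn_gt0 b0.
rewrite pfactorK // logn_coprime // coprime2n.
by rewrite oddD oddM /= andbF addbF -coprime2n.
Qed.

(** The binary Toeplitz sequence given by the parity of the 2-adic valuation. *)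
Definition toeplitz n : bool := odd (logn 2 n.+1).

Lemma toeplitz_shift J k i : (i.+1 < 2 ^ J)%N ->
  toeplitz (i + k * 2 ^ J) = toeplitz i.
Proof.
move=> iJ; rewrite /toeplitz -addSn logn2_shift //.
Qed.

Lemma toeplitz_even n : toeplitz n.*2 = false.
Proof. by rewrite /toeplitz logn_coprime // coprime2n /= odd_double. Qed.

Lemma toeplitz_4n1 n : toeplitz (n.*2.*2.+1) = true.
Proof.
rewrite /toeplitz; have -> : (n.*2.*2.+2 = n.*2.+1 * 2)%N by rewrite muln2; lia.
rewrite lognM // [logn 2 n.*2.+1]logn_coprime; first by rewrite logn_prime.
by rewrite coprime2n /= odd_double.
Qed.

Lemma toeplitz_not_periodic a d : (0 < d)%N ->
  exists2 n, (a <= n)%N & toeplitz (n + d) != toeplitz n.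
Proof.
(* take [n + 1 = d q] where [q] is odd and [q + 1] is twice an odd number *)
move=> d0; pose q := (a.*2.*2.+1)%N; exists (d * q).-1.
  have : (q <= d * q)%N by rewrite leq_pmull.
  by rewrite /q; lia.
have dq0 : (0 < d * q)%N by rewrite muln_gt0 d0.
rewrite /toeplitz -addSn prednK // -{2}[d]muln1 -mulnDr.
have q0 : (0 < q)%N by [].
have lq : logn 2 q = 0%N.
  by rewrite logn_coprime // coprime2n /q /= odd_double.
have lq1 : logn 2 (q + 1) = 1%N.
  have -> : (q + 1 = a.*2.+1 * 2)%N by rewrite /q muln2; lia.
  rewrite lognM // [logn 2 a.*2.+1]logn_coprime; first by rewrite logn_prime.
  by rewrite coprime2n /= odd_double.
have q10 : (0 < q + 1)%N by rewrite addn1.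
by rewrite (lognM _ d0 q10) (lognM _ d0 q0) lq1 lq addn0 addn1 /=; case: odd.
Qed.

Section binary_expansion.
Context (R : realType).
Variable s : nat -> bool.
Local Notation nc := (@Normc.normc R).

(** Partial sums of the binary expansion with digits [s m, s (m + 1), ...]. *)
Definition partial m N : R := \sum_(n < N) (s (n + m))%:R / 2 ^+ n.+1.

Lemma partialS m N : partial m N.+1 = ((s m)%:R + partial m.+1 N) / 2.
Proof.
rewrite /partial big_ord_recl add0n expr1 mulrDl; congr (_ + _).
rewrite mulr_suml; apply: eq_bigr => n _.
by rewrite /= addSnnS [2 ^+ _.+1]exprSr invfM mulrA.
Qed.

Lemma partial_bound m N : 0 <= partial m N <= 1.
Proof.
elim: N m => [|N IH] m; first by rewrite /partial big_ord0 lexx ler01.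
rewrite partialS; have /andP[h1 h2] := IH m.+1.
by case: (s m) => /=; apply/andP; split; lra.
Qed.

Lemma partial_cvg m : cvgn (partial m).
Proof.
apply: nondecreasing_is_cvgn.
  apply/nondecreasing_seqP => N; rewrite /partial big_ord_recr /= lerDl.
  by rewrite divr_ge0 // exprn_ge0.
by exists 1 => _ [N _ <-]; case/andP: (partial_bound m N).
Qed.

(** The number with binary digits [s m, s (m + 1), ...]. *)
Definition expansion m : R := limn (partial m).

Lemma expansionE m : 2 * expansion m = (s m)%:R + expansion m.+1.
Proof.
have h1 : partial m (N.+1) @[N --> \oo] --> expansion m.
  by rewrite (cvg_shiftS (partial m)); exact: partial_cvg.
have h2 : partial m (N.+1) @[N --> \oo] --> ((s m)%:R + expansion m.+1) / 2.
  under eq_fun do rewrite partialS.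
  apply: cvgMl; apply: cvgD; first exact: cvg_cst.
  exact: partial_cvg.
have -> : expansion m = ((s m)%:R + expansion m.+1) / 2.
  exact: cvg_unique h1 h2.
by rewrite mulrCA divff ?mulr1.
Qed.

Lemma expansion_bound m : 0 <= expansion m <= 1.
Proof.
apply/andP; split.
  apply: limr_ge; first exact: partial_cvg.
  by apply: nearW => N; case/andP: (partial_bound m N).
apply: limr_le; first exact: partial_cvg.
by apply: nearW => N; case/andP: (partial_bound m N).
Qed.

Lemma expansion_near m n k : (forall i, (i < k)%N -> s (i + m) = s (i + n)) ->
  `|expansion m - expansion n| <= 2^-1 ^+ k.
Proof.
elim: k m n => [|k IH] m n h.
  have := expansion_bound m; have := expansion_bound n.
  by move=> /andP[? ?] /andP[? ?]; rewrite expr0 ler_norml; apply/andP; split; lra.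
have e1 := expansionE m; have e2 := expansionE n.
have s0 : s m = s n by have := h 0%N isT; rewrite !add0n.
have := IH m.+1 n.+1.
have h' i : (i < k)%N -> s (i + m.+1) = s (i + n.+1).
  by move=> ik; rewrite -!addSnnS; exact: h.
move=> /(_ h').
have -> : expansion m - expansion n = 2^-1 * (expansion m.+1 - expansion n.+1).
  by rewrite s0 in e1; lra.
rewrite normrM exprS gtr0_norm ?invr_gt0 // ler_pM2l ?invr_gt0 //.
Qed.

Lemma expansion_gt0 m : (exists2 n, (m <= n)%N & s n) -> 0 < expansion m.
Proof.
move=> [n mn sn]; rewrite -(subnK mn) in sn; move: (n - m)%N sn => k {mn n}.
elim: k m => [|k IH] m.
  rewrite add0n => sm; have := expansionE m; rewrite sm /=.
  by have /andP[? ?] := expansion_bound m.+1; lra.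
rewrite addSnnS => /IH h; have := expansionE m.
by case: (s m) => /=; lra.
Qed.

Lemma expansion_lt1 m : (exists2 n, (m <= n)%N & ~~ s n) -> expansion m < 1.
Proof.
move=> [n mn sn]; rewrite -(subnK mn) in sn; move: (n - m)%N sn => k {mn n}.
elim: k m => [|k IH] m.
  rewrite add0n => /negbTE sm; have := expansionE m; rewrite sm /=.
  by have /andP[? ?] := expansion_bound m.+1; lra.
rewrite addSnnS => /IH h; have := expansionE m.
by case: (s m) => /=; lra.
Qed.

(** The point of the circle with angle [2 pi] times the expansion. *)
Definition digit_point m : circle R := expi (expansion m * (pi *+ 2)).

Lemma digit_pointS m : circle_pow (digit_point m) 2 = digit_point m.+1.
Proof.
apply: cval_inj; rewrite cval_pow /digit_point -expiMn.
have -> : expansion m * (pi *+ 2) *+ 2 = (s m)%:R * (pi *+ 2) + expansion m.+1 * (pi *+ 2).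
  by rewrite -mulrDl -expansionE -mulr_natl mulrA.
rewrite expiD mulr_natl expiMn expiE cos2pi sin2pi.
by rewrite -[(1 +i* 0)%C]/(1 : R[i]) expr1n mul1r.
Qed.

Lemma digit_point_pow m k : circle_pow (digit_point m) (2 ^ k) = digit_point (k + m).
Proof.
elim: k m => [|k IH] m; first by rewrite circle_pow1.
by rewrite expnS -circle_powM digit_pointS IH addSnnS.
Qed.

End binary_expansion.

Section toeplitz_point.
Context (R : realType).
Local Notation nc := (@Normc.normc R).

Lemma cos_eq1 (u : R) : - (pi *+ 2) < u < pi *+ 2 -> cos u = 1 -> u = 0.
Proof.
move=> /andP[u1 u2] cu.
have : sin (u / 2) = 0.
  have u2E : (u / 2) *+ 2 = u by rewrite -mulr_natr mulfVK.
  have := cos_mulr2n (u / 2); rewrite u2E cu.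
  have := cos2Dsin2 (u / 2); set c := cos _; set t := sin _ => h1 h2.
  have /eqP : t ^+ 2 = 0 by rewrite -mulr_natl in h2; lra.
  by rewrite sqrf_eq0 => /eqP.
have [u0|u0|//] := ltgtP u 0.
  have : 0 < sin (- (u / 2)).
    by apply: sin_gt0_pi; rewrite mulr2n in u1; apply/andP; split; lra.
  by rewrite sinN => + E; rewrite E oppr0 ltxx.
have : 0 < sin (u / 2).
  by apply: sin_gt0_pi; rewrite mulr2n in u2; apply/andP; split; lra.
by move=> + E; rewrite E ltxx.
Qed.

Lemma expi_inj (x y : R) : 0 < x < 1 -> 0 < y < 1 ->
  expi (x * (pi *+ 2)) = expi (y * (pi *+ 2)) -> x = y.
Proof.
move=> /andP[x0 x1] /andP[y0 y1] /(congr1 (@cval R)); rewrite !expiE => -[hc hs].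
have pp := @pi2_gt0 R.
suff : x * (pi *+ 2) - y * (pi *+ 2) = 0.
  by rewrite -mulrBl => /eqP; rewrite mulf_eq0 subr_eq0 (gt_eqF pp) orbF => /eqP.
apply: cos_eq1; last first.
  by rewrite cosB hc hs -!expr2 cos2Dsin2.
rewrite -mulrBl; set t := pi *+ 2 in pp *.
by apply/andP; split; nra.
Qed.

Local Notation y := (expansion R toeplitz).
Local Notation zeta := (digit_point R toeplitz 0).

Lemma toeplitz_expansion_bound m : 0 < y m < 1.
Proof.
apply/andP; split.
  apply: expansion_gt0; exists (m.*2.*2.+1)%N; last by rewrite toeplitz_4n1.
  by lia.
apply: expansion_lt1; exists m.*2; last by rewrite toeplitz_even.
by lia.
Qed.

Lemma toeplitz_expansion_inj m n : y m = y n -> toeplitz m = toeplitz n /\ y m.+1 = y n.+1.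
Proof.
move=> E; have := expansionE R toeplitz m; rewrite E expansionE.
have /andP[? ?] := toeplitz_expansion_bound m.+1.
have /andP[? ?] := toeplitz_expansion_bound n.+1.
by case: (toeplitz m); case: (toeplitz n) => /= h; split => //; lra.
Qed.

(** If [zeta^N = 1] then the orbit of [zeta] under squaring is eventually
    periodic; as the expansions lie in the open unit interval, so is the
    sequence of digits. *)
Lemma toeplitz_not_root_of_unity : not_root_of_unity zeta.
Proof.
move=> N N0; apply/eqP => zN.
have [b cb NE] := pfactor_coprime (isT : prime 2) N0.
set a := logn 2 N in NE; pose d := totient b.
have b0 : (0 < b)%N by move: N0; rewrite NE muln_gt0 => /andP[].
have d0 : (0 < d)%N by rewrite totient_gt0.
have dvd : (N %| 2 ^ (a + d) - 2 ^ a)%N.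
  rewrite expnD -{2}[(2 ^ a)%N]muln1 -mulnBr NE mulnC dvdn_mul //.
  rewrite -eqn_mod_dvd ?expn_gt0 //; apply/eqP.
  exact: cyclic.Euler_exp_totient.
have E : circle_pow zeta (2 ^ (a + d)) = circle_pow zeta (2 ^ a).
  apply: cval_inj; rewrite !cval_pow.
  rewrite -(subnK (_ : 2 ^ a <= 2 ^ (a + d)))%N; last first.
    by rewrite leq_exp2l // leq_addr.
  have /dvdnP[c ->] := dvd.
  by rewrite exprD mulnC exprM zN expr1n mul1r.
rewrite !digit_point_pow !addn0 in E.
have Ey := expi_inj (toeplitz_expansion_bound _) (toeplitz_expansion_bound _) E.
have per n : y (n + (a + d)) = y (n + a).
  by elim: n => // n IH; rewrite !addSn; case: (toeplitz_expansion_inj IH).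
have [n an /eqP[]] := toeplitz_not_periodic a d0.
have := per (n - a)%N; rewrite addnA subnK // => h.
by have [] := toeplitz_expansion_inj h.
Qed.

(** Shifting the digits by a multiple of [2^J] preserves the first [2^J - 1]
    of them. *)
Lemma toeplitz_recurrent : recurrent zeta.
Proof.
move=> e e0.
have [d d0 hd] : exists2 d : R, 0 < d & forall x, `|x - y 0| < d ->
    nc (cval (expi (x * (pi *+ 2))) - cval zeta) < e.
  have c : continuous (fun x : R => expi (x * (pi *+ 2)) : circle R).
    move=> x; apply: continuous_comp; last exact: expi_continuous.
    by apply: cvgM; [exact: cvg_id|exact: cvg_cst].
  have : nbhs (y 0) ((fun x : R => expi (x * (pi *+ 2)) : circle R) @^-1`
     [set w | nc (cval w - cval zeta) < e]).
    by apply: c; apply/nbhs_circleP; exists e.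
  move=> /nbhs_ballP[d /= d0 h]; exists d => // x xd; apply: h.
  by rewrite /ball /= distrC.
have half01 : 0 <= (2^-1 : R) < 1.
  by rewrite invr_ge0 ler0n /= invf_lt1 // ltr1n.
have [J hJ] := geometric_small 1 half01 d0.
exists (2 ^ J)%N; first by rewrite expn_gt0.
move=> k; rewrite digit_point_pow addn0; apply: hd.
apply: (@le_lt_trans _ _ (2^-1 ^+ (2 ^ J).-1)).
  apply: expansion_near => i iJ; rewrite addn0 toeplitz_shift //.
  by move: iJ; rewrite -ltnS prednK // expn_gt0.
rewrite -[ltLHS]mul1r; apply: hJ.
by have := ltn_expl J (isT : (1 < 2)%N); lia.
Qed.

End toeplitz_point.

(** * Separation of points *)

Section separation.
Context (R : realType).
Implicit Types (a : fseries R).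
Local Notation nc := (@Normc.normc R).

(** A finite part of an infinite orbit is separated. *)
Lemma orbit_separated (z : circle R) (m N : nat) : not_root_of_unity z ->
  exists2 r : R, 0 < r & forall n, (n < N)%N -> n != m ->
    r <= nc (cval (circle_pow z (2 ^ n)) - cval (circle_pow z (2 ^ m))).
Proof.
move=> hz; elim: N => [|N [r r0 hr]]; first by exists 1.
have [Nm|Nm] := eqVneq N m.
  exists r => // n; rewrite ltnS leq_eqVlt => /orP[/eqP ->|]; last exact: hr.
  by rewrite Nm eqxx.
exists (Num.min r (nc (cval (circle_pow z (2 ^ N)) - cval (circle_pow z (2 ^ m))))).
  rewrite lt_min r0 lt_neqAle nc_ge0 andbT eq_sym; apply: contra Nm => /eqP/nc_eq0.
  by move=> /eqP; rewrite subr_eq0 => /eqP/cval_inj/(orbit_inj hz) ->.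
move=> n; rewrite ltnS leq_eqVlt => /orP[/eqP -> _|nN nm].
  by rewrite ge_min lexx orbT.
by rewrite ge_min hr.
Qed.

(** If all functions of the Wiener algebra are killed at [z], so are all the
    coefficients: test against bumps at the points of the orbit. *)
Lemma coefficients_eq0 a (z : circle R) : not_root_of_unity z -> dominated a ->
  (forall g, wiener g -> gact g a z = 0) -> forall m, a m z = 0.
Proof.
move=> hz da h m; have [al cal hal] := da.
have al0 k : 0 <= al k by exact: le_trans (nc_ge0 _) (hal k z).
apply: nc_eq0; apply/eqP; rewrite eq_le nc_ge0 andbT.
apply/ler_addgt0Pr => e e0; rewrite add0r.
have [N hN] := series_tail_le al0 cal e0.
(* beyond [M] the tail is small, and [M] exceeds [m] *)
pose M := (N + m.+1)%N.
have [r r0 hr] := orbit_separated m M hz.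
have [g [[C hC] g1 g01 gz]] := wiener_bump (circle_pow z (2 ^ m)) r0.
have [wg _] := wball_wiener hC.
have gle w : nc (rfun g w) <= 1.
  by rewrite /rfun nc_real ger0_norm; case/andP: (g01 w).
rewrite -ncN -[- a m z]add0r -(h _ wg).
have := @dominated_cvg _ (rfun g) a z 1 gle da.
move=> hcv; apply: (nc_limn_le hcv); exists M => // n /= Mn.
have mM : (m < M)%N by rewrite /M addnS ltnS leq_addl.
rewrite /series /= (big_cat_nat (leq0n M) Mn) /=.
have -> : \sum_(0 <= i < M) rfun g (circle_pow z (2 ^ i)) * a i z = a m z.
  rewrite big_mkord (bigD1 (Ordinal mM)) //= big1 ?addr0.
    by rewrite /rfun g1 mul1r.
  by move=> i im; rewrite /rfun gz ?mul0r // hr.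
rewrite addrC addrK; apply: (le_trans (nc_sum _ _ _)).
apply: (@le_trans _ _ (\sum_(M <= i < n) al i)); last first.
  by apply: hN => //; rewrite leq_addr.
apply: ler_sum => i _; rewrite ncM -[leRHS]mul1r.
by apply: ler_pM; rewrite ?nc_ge0.
Qed.

Lemma separation a : (forall m, continuous (a m)) -> dominated a -> a <> 0 ->
  exists (K : set (circle R)) (muK : mu_set K), infinite_set K /\
    exists2 f, WK K f & act (mu_square muK) f a <> 0.
Proof.
move=> ca da a0; apply: contrapT => H; apply: a0.
pose zeta := digit_point R toeplitz 0.
have rz : recurrent zeta := @toeplitz_recurrent R.
have nz : not_root_of_unity zeta := @toeplitz_not_root_of_unity R.
apply/funext => m; apply/funext => w.
apply: (continuous_eq0_powers nz (ca m)) => q q0.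
have nzq := not_root_of_unity_pow q0 nz.
apply: (coefficients_eq0 nzq da) => g wg.
have muK := recurrent_mu_set (recurrent_pow q rz).
apply: contrapT => h; apply: H.
exists (closure (orbit (circle_pow zeta q))), muK; split.
  exact: orbit_closure_infinite.
exists (g \o set_val); first by exists g.
move=> E; apply: h.
have zK : circle_pow zeta q \in closure (orbit (circle_pow zeta q)).
  exact/mem_set/orbit_closure_self.
exact: (congr1 (fun f => f (SigSub zK)) E).
Qed.

End separation.

Unset Implicit Arguments.
Set Strict Implicit.
Set Printing Implicit Defensive.

Theorem mainTheorem6 (R : realType) :
  ((forall (K : set (circle R)) (muK : mu_set K), infinite_set K ->
      [/\ right_module algA fmul fone (act (mu_square muK)) (WK K),
          irreducible_module algA (act (mu_square muK)) (WK K)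
        & infinite_dimensional (WK K)]) /\
   (forall a : fseries R, algA a -> a <> 0 ->
      exists (K : set (circle R)) (muK : mu_set K), infinite_set K /\
        exists2 f, WK K f & act (mu_square muK) f a <> 0))
  /\
  ((forall (K : set (circle R)) (muK : mu_set K), infinite_set K ->
      [/\ right_module algB fmul fone (act (mu_square muK)) (CK K),
          irreducible_module algB (act (mu_square muK)) (CK K)
        & infinite_dimensional (CK K)]) /\
   (forall a : fseries R, algB a -> a <> 0 ->
      exists (K : set (circle R)) (muK : mu_set K), infinite_set K /\
        exists2 f, CK K f & act (mu_square muK) f a <> 0)).
Proof.
have FW := function_algebra_wiener R; have FC := function_algebra_continuous R.
split; split.
- move=> K muK infK; rewrite WK_restrictions; split.
  + exact: (right_module_restrictions FW (mu_square muK)).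
  + exact: (irreducible_restrictions FW muK).
  + exact: (infinite_dimensional_restrictions FW infK).
- move=> a Aa a0; apply: separation a0; last exact: (fa_dom FW Aa).
  by move=> m; case: Aa => /(_ m) [].
- move=> K muK infK; rewrite (CK_restrictions (mu_compact muK)); split.
  + exact: (right_module_restrictions FC (mu_square muK)).
  + exact: (irreducible_restrictions FC muK).
  + exact: (infinite_dimensional_restrictions FC infK).
- move=> a Ba a0; have [ca _] := Ba.
  have [K [muK [infK [f [g wg fE] fa]]]] := separation ca (fa_dom FC Ba) a0.
  exists K, muK; split => //; exists f => //.
  rewrite (CK_restrictions (mu_compact muK)); exists g => //.
  exact: (fa_cont FW wg).
Qed.
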